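(* Let $M\ge2$, let $\mathsf{G}_\omega:[-1,1]\to\mathbb{C}^{M\times M}$ have entries that are rational functions of $x$ without poles in $[-1,1]$, let $\mathbf{f}=(f_1,\dots,f_M)^\top:[-1,1]\to\mathbb{C}^M$, and let $\nu$ be an even positive integer with $\nu\ge d+1$, where $d$ is as defined in the context. Consider the system $$\mathsf{P}_{M,\nu}\widetilde{\mathsf{A}}\mathsf{P}_{M,\nu}\boldsymbol{\alpha}_0=\mathsf{P}_{M,\nu}\tilde{\mathbf{F}},\qquad \boldsymbol{\alpha}_0=\mathsf{P}_{M,\nu}\boldsymbol{\alpha}_0\in\mathbb{C}^{M(\nu+2)},$$ with $\mathsf{P}_{M,\nu}$, $\widetilde{\mathsf{A}}$, $\tilde{\mathbf{F}}$ as defined in the context. Once a solution exists, the system can be solved using $\mathcal{O}(M\nu\log\nu+M^3\max\{1,d\}^2\nu)$ operations, by a simple reordering together with the block-wise application of discrete cosine transforms (DCT-I) and the solution of a banded matrix system of bandwidth at most $2M(d+4)-1$.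
   Context: $\mathrm{T}_n$ is the Chebyshev polynomial of the first kind of degree $n$, and $c_m=\cos\bigl(m\pi/(\nu+1)\bigr)$, $0\le m\le\nu+1$, are the Clenshaw--Curtis points. Let $r(x)$ be the least common multiple of all denominators (in lowest terms) of the entries of $\mathsf{G}_\omega$, so that every entry of $r\mathsf{G}_\omega$ is a polynomial in $x$ and $r$ has no zeros in $[-1,1]$. Put $d_1=\deg r$, $d_2=\max_{1\le i,j\le M}\deg\bigl(r\mathsf{G}_\omega\bigr)_{ij}-1$ (degrees in $x$), and $d=\max\{d_1,d_2\}$. The matrix $\widetilde{\mathsf{A}}$ is the $M(\nu+2)\times M(\nu+2)$ matrix made of $M\times M$ blocks $\widetilde{\mathsf{A}}^{[i,j]}$ of size $(\nu+2)\times(\nu+2)$, with $$\widetilde{\mathsf{A}}^{[i,j]}_{mn}=(1-c_m^2)\Bigl[\delta_{ij}\,r(x)\mathrm{T}_n'(x)+r(x)(\mathsf{G}_\omega^\top(x))_{ij}\mathrm{T}_n(x)\Bigr]_{x=c_m},\quad 1\le i,j\le M,\ 0\le m,n\le\nu+1,$$ i.e. the collocation matrix of $\widetilde{\boldsymbol{\mathcal{L}}}_\omega=(1-x^2)r(x)\frac{\mathrm{d}}{\mathrm{d}x}+(1-x^2)r(x)\mathsf{G}_\omega^\top$ in the Chebyshev basis. The right-hand side is $\tilde{\mathbf{F}}=(\tilde{\mathbf{F}}^{[1]},\dots,\tilde{\mathbf{F}}^{[M]})$ with $\tilde{\mathbf{F}}^{[i]}_m=(1-c_m^2)r(c_m)f_i(c_m)$.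 The projection $\mathsf{P}_{M,\nu}$ acts on $(\mathbf{x}^{[1]},\dots,\mathbf{x}^{[M]})$, $\mathbf{x}^{[k]}\in\mathbb{C}^{\nu+2}$, by applying to each block the map $(x_0,\dots,x_{\nu+1})\mapsto(0,x_1,\dots,x_\nu,0)$. A matrix is banded of bandwidth $2b+1$ if its $(i,j)$ entry vanishes whenever $|i-j|>b$. The DCT-I on $\mathbb{C}^{\nu+2}$ is the map $\mathbf{x}\mapsto\bigl(\tfrac12x_0+\sum_{n=1}^{\nu}\cos\tfrac{mn\pi}{\nu+1}\,x_n+\tfrac12(-1)^m x_{\nu+1}\bigr)_{m=0}^{\nu+1}$, which can be applied in $\mathcal{O}(\nu\log\nu)$ operations. ''Operations'' are arithmetic operations on complex numbers; the input consists of the coefficients of $r$ and of the entries of $r\mathsf{G}_\omega$ and the values $\mathbf{f}(c_m)$. *)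

(* Defs.v *)
From HB Require Import structures.
From mathcomp Require Export all_boot all_order all_algebra.
From mathcomp Require Export reals trigo exp.
From mathcomp Require Export complex mxtens.

Set Implicit Arguments.
Unset Strict Implicit.
Unset Printing Implicit Defensive.
Import Order.TTheory GRing.Theory Num.Theory.

Local Open Scope ring_scope.
Local Open Scope complex_scope.

(* The complex numbers are R[i], for an arbitrary R : realType. *)

Fixpoint chebT (F : nzRingType) (n : nat) : {poly F} :=
  match n with
  | 0 => 1
  | n1.+1 => match n1 with
             | 0 => 'X
             | n2.+1 => 'X * chebT F n1 *+ 2 - chebT F n2
             end
  end.

Definition cc_point (R : realType) (nu m : nat) : R :=
  cos (m%:R * pi / nu.+1%:R).

(* On [-1, 1], G is the matrix of rational functions num i j / den i j, in
   lowest terms and without poles; num i j = 0 forces den i j to be constant. *)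
Definition lowest_terms (R : realType) (M : nat) (G : R -> 'M[R[i]]_M)
    (num den : 'M[{poly R[i]}]_M) : Prop :=
  forall i j, coprimep (num i j) (den i j) /\
    forall x : R, -1 <= x <= 1 ->
      (den i j).[x%:C] != 0 /\
      G x i j = (num i j).[x%:C] / (den i j).[x%:C].

(* An lcm is determined up to a nonzero scalar factor only; results are stated
   for every choice of it. *)
Definition is_lcm_entries (F : fieldType) (M : nat) (den : 'M[{poly F}]_M)
    (r : {poly F}) : Prop :=
  (forall i j, den i j %| r) /\
  (forall s : {poly F}, (forall i j, den i j %| s) -> r %| s).

(* The polynomial matrix r G; the quotients are exact when r is a common
   multiple of the denominators. *)
Definition clear_denoms (F : fieldType) (M : nat)
    (num den : 'M[{poly F}]_M) (r : {poly F}) : 'M[{poly F}]_M :=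
  \matrix_(i, j) (r %/ den i j * num i j).

(* max {deg r, max_ij deg (rG)_ij - 1}.  As size p = deg p + 1 and subtraction
   is truncated, the second term is 0 rather than negative when all entries of
   rG are constant, which does not affect the maximum. *)
Definition total_degree (F : fieldType) (M : nat) (r : {poly F})
    (rG : 'M[{poly F}]_M) : nat :=
  maxn (size r).-1 (\max_(i < M) \max_(j < M) (size (rG i j)).-1).-1.

(* Vectors in C^{M (nu + 2)} are stored block after block: the flat index
   k = i (nu + 2) + m, decoded by mxtens_unindex, is entry m of block i. *)

Definition colloc_block (R : realType) (M nu : nat) (G : R -> 'M[R[i]]_M)
    (r : {poly R[i]}) (i j : 'I_M) : 'M[R[i]]_nu.+2 :=
  \matrix_(m, n)
    let c := cc_point R nu m in
    (1 - c%:C ^+ 2) *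
    ((i == j)%:R * (r.[c%:C] * (chebT R[i] n)^`().[c%:C])
     + r.[c%:C] * (G c)^T i j * (chebT R[i] n).[c%:C]).

Definition colloc_mx (R : realType) (M nu : nat) (G : R -> 'M[R[i]]_M)
    (r : {poly R[i]}) : 'M[R[i]]_(M * nu.+2) :=
  \matrix_(k, l)
    let (i, m) := mxtens_unindex k in
    let (j, n) := mxtens_unindex l in
    colloc_block nu G r i j m n.

Definition colloc_rhs (R : realType) (M nu : nat) (f : R -> 'cV[R[i]]_M)
    (r : {poly R[i]}) : 'cV[R[i]]_(M * nu.+2) :=
  \col_k
    let (i, m) := mxtens_unindex k in
    let c := cc_point R nu m in
    (1 - c%:C ^+ 2) * r.[c%:C] * f c i 0.

Definition inner_index (nu n : nat) : bool := (0 < n < nu.+1)%N.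

(* The identity matrix tensored with B applies B to each of the M blocks. *)
Definition blockwise (F : fieldType) (M N : nat) (B : 'M[F]_N) :
  'M[F]_(M * N) := (1%:M : 'M[F]_M) *t B.

Definition proj_mx0 (F : fieldType) (M nu : nat) : 'M[F]_(M * nu.+2) :=
  blockwise M (\matrix_(m < nu.+2, n < nu.+2) ((m == n) && inner_index nu m)%:R).

Definition is_solution (R : realType) (M nu : nat) (G : R -> 'M[R[i]]_M)
    (f : R -> 'cV[R[i]]_M) (r : {poly R[i]}) (a : 'cV[R[i]]_(M * nu.+2)) :=
  let P := proj_mx0 R[i] M nu in
  P *m colloc_mx nu G r *m P *m a = P *m colloc_rhs nu f r /\ a = P *m a.

Definition dct1 (R : realType) (nu : nat) : 'M[R[i]]_nu.+2 :=
  \matrix_(m, n)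
    (if n == 0 :> nat then 2^-1
     else if n == nu.+1 :> nat then (-1) ^+ m / 2
     else cos ((m * n)%:R * pi / nu.+1%:R))%:C.

(* Interleaving of M blocks of length N: entry m of block i, stored at position
   i N + m, is moved to position m M + i; swap_index maps new to old positions. *)
Definition swap_index (M N : nat) (k : 'I_(N * M)) : 'I_(M * N) :=
  mxtens_index ((mxtens_unindex k).2, (mxtens_unindex k).1).

Definition reorder_mx (F : fieldType) (M N : nat) (A : 'M[F]_(M * N)) :
  'M[F]_(N * M) := mxsub (@swap_index M N) (@swap_index M N) A.

Definition reorder_col (F : fieldType) (M N : nat) (v : 'cV[F]_(M * N)) :
  'cV[F]_(N * M) := rowsub (@swap_index M N) v.

Definition bandwidth_at_most (F : fieldType) (n w : nat) (A : 'M[F]_n) :=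
  exists2 b : nat, (2 * b + 1 <= w)%N &
    forall i j : 'I_n, (b < `|i - j|)%N -> A i j = 0.

Definition reduced_mx (R : realType) (M nu : nat) (G : R -> 'M[R[i]]_M)
    (r : {poly R[i]}) : 'M[R[i]]_(nu.+2 * M) :=
  let P := proj_mx0 R[i] M nu in
  reorder_mx (blockwise M (dct1 R nu) *m (P *m colloc_mx nu G r *m P)).

Definition reduced_rhs (R : realType) (M nu : nat)
    (f : R -> 'cV[R[i]]_M) (r : {poly R[i]}) : 'cV[R[i]]_(nu.+2 * M) :=
  reorder_col (blockwise M (dct1 R nu)
                 *m (proj_mx0 R[i] M nu *m colloc_rhs nu f r)).

(* Inputs InR, InG, InF; the banded matrix Mat; the vectors Val (blockwise),
   Rhs and Sol (reordered), Out (blockwise); and scratch registers Tmp. *)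
Inductive reg : Type :=
| InR of nat
| InG of nat & nat & nat
| InF of nat & nat
| Mat of nat & nat
| Val of nat
| Rhs of nat
| Sol of nat
| Out of nat
| Tmp of seq nat.

Lemma reg_comparable : comparable reg.
Proof.
by move=> x y; rewrite /decidable; decide equality; exact: eq_comparable.
Qed.

HB.instance Definition _ := hasDecEq.Build reg (compareP reg_comparable).

Inductive arith := OpAdd | OpSub | OpMul | OpDiv.

(* Loop-free programs.  The constants, the registers addressed and the branching
   structure are fixed by the program; data can only be accessed through
   arithmetic and tests for zero. *)
Inductive prog (F : Type) : Type :=
| Skip
| Seq of prog F & prog F
| Const of reg & F
| Move of reg & reg
| Arith of arith & reg & reg & reg
| IfZero of reg & prog F & prog F.
Arguments Skip {F}.
Arguments Move {F}.
Arguments Arith {F}.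

Definition store (F : Type) := reg -> F.

Definition update (F : Type) (s : store F) (z : reg) (v : F) : store F :=
  fun z' => if z' == z then v else s z'.

Definition arith_eval (F : fieldType) (o : arith) (x y : F) : option F :=
  match o with
  | OpAdd => Some (x + y)
  | OpSub => Some (x - y)
  | OpMul => Some (x * y)
  | OpDiv => if y == 0 then None else Some (x / y)
  end.

(* Number of operations performed and final store; None on a division by zero.
   Arithmetic operations and tests are charged 1; constants and copies are
   free. *)
Fixpoint run (F : fieldType) (p : prog F) (s : store F) :
    option (nat * store F) :=
  match p with
  | Skip => Some (0%N, s)
  | Seq p1 p2 =>
      if run p1 s is Some (n1, s1) then
        if run p2 s1 is Some (n2, s2) then Some ((n1 + n2)%N, s2) else None
      else None
  | Const z c => Some (0%N, update s z c)
  | Move z x => Some (0%N, update s z (s x))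
  | Arith o z x y =>
      if arith_eval o (s x) (s y) is Some v then Some (1%N, update s z v)
      else None
  | IfZero x p1 p2 =>
      if run (if s x == 0 then p1 else p2) s is Some (n, s') then
        Some (n.+1, s')
      else None
  end.

Definition runs_within (R : realType) (F : fieldType) (p : prog F)
    (s : store F) (c : R) (Q : store F -> Prop) : Prop :=
  exists n s', [/\ run p s = Some (n, s'), n%:R <= c & Q s'].

Definition holds_vec (F : fieldType) (n : nat) (z : nat -> reg) (s : store F)
    (v : 'cV[F]_n) : Prop := forall k : 'I_n, s (z k) = v k 0.

(* Only the entries inside the band are stored. *)
Definition holds_band (F : fieldType) (n w : nat) (s : store F)
    (A : 'M[F]_n) : Prop :=
  forall k l : 'I_n, (2 * `|k - l| + 1 <= w)%N -> s (Mat k l) = A k l.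

(* Coefficients of degree <= d of r and <= d + 1 of the entries of rG, and the
   values of f at the collocation points; other registers are arbitrary. *)
Definition holds_input (R : realType) (M nu d : nat) (r : {poly R[i]})
    (rG : 'M[{poly R[i]}]_M) (f : R -> 'cV[R[i]]_M) (s : store R[i]) : Prop :=
  [/\ forall k, (k <= d)%N -> s (InR k) = r`_k,
      forall (i j : 'I_M) k, (k <= d.+1)%N -> s (InG i j k) = (rG i j)`_k
    & forall (i : 'I_M) (m : 'I_nu.+2), s (InF i m) = f (cc_point R nu m) i 0].

Definition gather_prog (F : fieldType) (M N : nat) : prog F :=
  \big[@Seq F/Skip]_(k < N * M) Move (Rhs k) (Val (@swap_index M N k)).

(* Undoes the reordering and applies the projection. *)
Definition scatter_prog (F : fieldType) (M nu : nat) : prog F :=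
  \big[@Seq F/Skip]_(k < M * nu.+2)
    if inner_index nu (mxtens_unindex k).2
    then Move (Out k) (Sol (@swap_index nu.+2 M k)) else Const (Out k) 0.

Definition is_dct_prog (R : realType) (M nu : nat) (p : prog R[i]) (c : R) :=
  forall (s : store R[i]) (v : 'cV[R[i]]_(M * nu.+2)),
    holds_vec Val s v ->
    runs_within p s c
      (fun s' => holds_vec Val s' (blockwise M (dct1 R nu) *m v)).

Definition is_band_solver (R : realType) (n w : nat) (p : prog R[i]) (c : R) :=
  forall (s : store R[i]) (B : 'M[R[i]]_n) (g : 'cV[R[i]]_n),
    bandwidth_at_most w B -> holds_band w s B -> holds_vec Rhs s g ->
    (exists y, B *m y = g) ->
    runs_within p s c
      (fun s' => exists2 y : 'cV[R[i]]_n, holds_vec Sol s' y & B *m y = g).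

(* Main.v *)
Require Import Defs.
From mathcomp Require Import zify ring.

Set Implicit Arguments.
Unset Strict Implicit.
Unset Printing Implicit Defensive.
Import Order.TTheory GRing.Theory Num.Theory.
Local Open Scope ring_scope.
Local Open Scope complex_scope.

(** In the Chebyshev basis, the product with a polynomial of degree s couples
    T_n only to T_l with |l - n| <= s, because x T_n = (T_(n-1) + T_(n+1)) / 2.
    Differentiation alone would fill a triangle, but (1 - x^2) T_n' is again a
    combination of x T_n and T_(n+1) ([chebT_deriv]), so the column n of the
    cleared collocation operator is the polynomial
    (1 - x^2) (r T_n' + (rG) T_n), whose Chebyshev coefficients are
    concentrated at |l - n| <= d + 3.  Collocation at the nodes followed by the
    DCT-I returns these coefficients up to aliasing, that is, up to reflecting
    the index l at 0 and at nu + 1, and a reflection never increases the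
    distance to n ([reflection_bound], [dct_poly_far]).  Each of the M x M blocks thus
    becomes banded, and interleaving the blocks gives the half bandwidth
    M (d + 3) + M - 1 ([reduced_band]).  The square of the DCT-I is diagonal
    and positive, so the transform is injective and the reduced system has the
    same solutions as the collocation system ([dct1_inj],
    [solution_of_reduced]).

    The program has three parts.

    Assembly: every entry inside the band is a linear combination of the
    O(d) coefficients of r and of one entry of rG, with weights that depend on
    the indices only and are therefore constants of the program
    ([within_assemble]).

    DCT-I of arbitrary length in O(nu log nu): an even extension turns the
    cosine sum into a Fourier sum, and the identity
    2 m n = (m + n)^2 - m^2 - n^2 turns the latter into the product with a
    Hankel matrix h(m + n), as in Bluestein's algorithm.  Any h of length L is
    an exponential sum of L-th roots of unity, by the invertibility of a
    Vandermonde matrix; hence the Hankel matrix is a corner of F D F with F the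
    Fourier matrix of length L and D diagonal ([bluestein]).  Taking L a power
    of two, F is applied by the radix-2 fast Fourier transform ([within_fft]).

    Solution of the banded system, which may be singular but is consistent:
    Gaussian elimination column by column, where the pivot is the first unused
    row with a nonzero entry.  As row i ends at column i + b and only rows
    below the pivot row are modified, there is no fill-in outside the band, and
    each of the n columns costs O(b^2) ([within_band_solve]). *)

(** * Running programs within a budget *)

(* The comparison of registers does not compute, its decidability being an
   opaque lemma; registers with different constructors are told apart by
   discrimination instead. *)
#[local] Hint Extern 0 (is_true (~~ (_ == _))) =>
  (apply/eqP; discriminate) : core.
#[local] Hint Extern 0 (is_true (~~ _)) =>
  (apply/eqP; discriminate) : core.

Section Programs.
Variable F : fieldType.
Implicit Types (p : prog F) (s : store F) (Q : store F -> Prop).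

(** The postcondition comes last, so that the rules below run a program
    symbolically from front to back.  Budgets are natural numbers; real-valued
    bounds enter only through [within_runs_within]. *)
Definition within (c : nat) p s Q :=
  exists n s', [/\ run p s = Some (n, s'), (n <= c)%N & Q s'].

Lemma within_weaken c c' p s Q Q' :
  within c p s Q -> (c <= c')%N -> (forall s', Q s' -> Q' s') ->
  within c' p s Q'.
Proof.
by move=> [n [s' [rp nc Qs]]] cc QQ; exists n, s'; split=> //;
  [exact: leq_trans cc | exact: QQ].
Qed.

Lemma within_skip s Q : Q s -> within 0 Skip s Q.
Proof. by exists 0%N, s. Qed.

Lemma within_seq c1 c2 p1 p2 s Q :
  within c1 p1 s (fun s1 => within c2 p2 s1 Q) ->
  within (c1 + c2) (Seq p1 p2) s Q.
Proof.
move=> [n1 [s1 [r1 l1 [n2 [s2 [r2 l2 Qs]]]]]].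
by exists (n1 + n2)%N, s2; rewrite /= r1 r2 leq_add.
Qed.

Lemma within_const z a s Q : Q (update s z a) -> within 0 (Const z a) s Q.
Proof. by move=> Qs; exists 0%N, (update s z a). Qed.

Lemma within_move z x s Q : Q (update s z (s x)) -> within 0 (Move z x) s Q.
Proof. by move=> Qs; exists 0%N, (update s z (s x)). Qed.

Lemma within_arith o z x y v s Q :
  arith_eval o (s x) (s y) = Some v -> Q (update s z v) ->
  within 1 (Arith o z x y) s Q.
Proof. by move=> e Qs; exists 1%N, (update s z v); rewrite /= e. Qed.

Lemma within_ifzero x p1 p2 c s Q :
  (s x = 0 -> within c p1 s Q) -> (s x != 0 -> within c p2 s Q) ->
  within c.+1 (IfZero x p1 p2) s Q.
Proof.
move=> H1 H2; case: (eqVneq (s x) 0) => [x0|x0].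
  have [n [s' [r l Qs]]] := H1 x0.
  by exists n.+1, s'; rewrite /= x0 eqxx r.
have [n [s' [r l Qs]]] := H2 x0.
by exists n.+1, s'; rewrite /= (negbTE x0) r.
Qed.

Lemma updateE s z a x : update s z a x = if x == z then a else s x.
Proof. by []. Qed.

(** The iterations of a loop may be analysed as if they ran in parallel.  When
    the sets W i are disjoint, the iteration i still finds the initial store in
    W i and outside all of the W j, up to the shared scratch registers X. *)
Lemma within_par (I : eqType) (l : seq I) (body : I -> prog F) (c : nat)
    (W : I -> pred reg) (X : pred reg) (v : I -> store F) s :
  uniq l ->
  (forall i j z, i \in l -> j \in l -> W i z -> W j z -> i = j) ->
  (forall i s1, i \in l ->
     (forall z, ~~ X z -> (forall j, j \in l -> j != i -> ~~ W j z) ->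
        s1 z = s z) ->
     within c (body i) s1 (fun s2 => forall z, ~~ X z ->
        s2 z = if W i z then v i z else s1 z)) ->
  within (size l * c) (\big[@Seq F/Skip]_(i <- l) body i) s
    (fun s' => forall z, ~~ X z ->
       (forall i, i \in l -> W i z -> s' z = v i z) /\
       ((forall i, i \in l -> ~~ W i z) -> s' z = s z)).
Proof.
move=> ul dW Hb.
suff H : forall r s1, uniq r -> {subset r <= l} ->
    (forall z, ~~ X z -> (forall j, j \in l -> j \notin r -> ~~ W j z) ->
       s1 z = s z) ->
    within (size r * c) (\big[@Seq F/Skip]_(i <- r) body i) s1
    (fun s' => forall z, ~~ X z ->
       (forall i, i \in r -> W i z -> s' z = v i z) /\
       ((forall i, i \in r -> ~~ W i z) -> s' z = s1 z)).
  by apply: H.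
elim=> [|i r IH] s1 /= ur sr agree.
  by rewrite big_nil; apply: within_skip.
rewrite big_cons mulSn; apply: within_seq.
case/andP: ur => nir ur.
have il : i \in l by apply: sr; rewrite mem_head.
apply: (within_weaken (Hb i s1 il _)) => //.
  move=> z Xz Hz; apply: agree => // j jl; rewrite inE negb_or => /andP[ji _].
  exact: Hz.
move=> s2 Hs2; apply: within_weaken (IH s2 ur _ _) _ _ => //.
- by move=> x xr; apply: sr; rewrite inE xr orbT.
- move=> z Xz Hz; rewrite Hs2 // (negbTE (Hz _ _ _)) //.
  apply: agree => // j jl; rewrite inE negb_or => /andP[_ jr]; exact: Hz.
move=> s' Hs' z Xz; have [H1 H2] := Hs' z Xz; split=> [j|Hz].
  rewrite inE => /orP[/eqP->{j} Wiz|]; last exact: H1.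
  rewrite H2 ?Hs2 ?Wiz // => j jr; apply/negP => Wjz.
  move: nir; rewrite (dW i j z il (sr _ _) Wiz Wjz) ?jr //.
  by rewrite inE jr orbT.
rewrite H2 => [|j jr]; last by apply: Hz; rewrite inE jr orbT.
by rewrite Hs2 // (negbTE (Hz i _)) // mem_head.
Qed.

Lemma within_assign (I : eqType) (l : seq I) (body : I -> prog F) (c : nat)
    (z : I -> reg) (X : pred reg) (v : I -> F) s :
  uniq l -> {in l &, injective z} -> {in l, forall i, ~~ X (z i)} ->
  (forall i s1, i \in l ->
     (forall y, ~~ X y -> (forall j, j \in l -> j != i -> y != z j) ->
        s1 y = s y) ->
     within c (body i) s1 (fun s2 => s2 (z i) = v i /\
        forall y, ~~ X y -> y != z i -> s2 y = s1 y)) ->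
  within (size l * c) (\big[@Seq F/Skip]_(i <- l) body i) s
    (fun s' => {in l, forall i, s' (z i) = v i} /\
       (forall y, ~~ X y -> {in l, forall i, y != z i} -> s' y = s y)).
Proof.
move=> ul zI XzI Hb.
have := @within_par I l body c (fun i => pred1 (z i)) X (fun i _ => v i) s ul.
move=> /(_ _ _)/within_weaken; apply=> //.
- by move=> i j y il jl /= /eqP-> /eqP; apply: zI.
- move=> i s1 il Hs1; apply: (within_weaken (Hb i s1 il Hs1)) => //.
  move=> s2 [H1 H2] y Xy /=; case: eqVneq => [-> //|yz]; exact: H2.
- move=> s' Hs'; split=> [i il|y Xy Hy].
    by have [/(_ i il)] := Hs' (z i) (XzI i il); rewrite /= eqxx => ->.
  by have [_ ->] := Hs' y Xy.
Qed.

(** Arithmetic takes its operands from registers; constants pass through this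
    one. *)
Definition scratch : reg := Tmp [::].

Definition is_tmp (z : reg) : bool := if z is Tmp _ then true else false.

Definition lincomb (z : reg) (l : seq (F * reg)) : prog F :=
  Seq (Const z 0)
    (\big[@Seq F/Skip]_(ax <- l)
       Seq (Const scratch ax.1)
         (Seq (Arith OpMul scratch scratch ax.2) (Arith OpAdd z z scratch))).

Lemma within_lincomb z (l : seq (F * reg)) s :
  z != scratch -> {in l, forall ax, (ax.2 != z) && (ax.2 != scratch)} ->
  within (2 * size l) (lincomb z l) s
    (fun s' => s' z = \sum_(ax <- l) ax.1 * s ax.2 /\
       forall y, y != scratch -> y != z -> s' y = s y).
Proof.
move=> zt Hl; rewrite -[(2 * _)%N]add0n; apply/within_seq/within_const.
set s0 := update s z 0.
have s0z : s0 z = 0 by rewrite /s0 updateE eqxx.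
have : forall y, y != scratch -> y != z -> s0 y = s y.
  by move=> y _ yz; rewrite /s0 updateE (negbTE yz).
move=> agree0.
apply: (@within_weaken _ _ _ _
  (fun s' => s' z = s0 z + \sum_(ax <- l) ax.1 * s ax.2 /\
     forall y, y != scratch -> y != z -> s' y = s y)) (leqnn _) _; last first.
  by rewrite s0z add0r.
move: s0 {s0z} agree0 Hl => s0; elim: l s0 => [|[a x] l IH] s0 agree Hl.
  by rewrite !big_nil addr0; apply: within_skip.
have /andP[/= xz xt] : (x != z) && (x != scratch).
  by apply: (Hl (a, x)); rewrite mem_head.
rewrite !big_cons /= mulnS; apply: within_seq.
rewrite -[2%N]/(0 + (1 + 1))%N; apply/within_seq/within_const.
apply: within_seq; apply: within_arith; first by [].
apply: within_arith; first by [].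
rewrite !updateE !eqxx (negbTE zt) (negbTE xt) (agree x) //.
set s1 := update _ z _.
have -> : s0 z + (a * s x + \sum_(j <- l) j.1 * s j.2) =
    s1 z + \sum_(j <- l) j.1 * s j.2.
  by rewrite /s1 updateE eqxx addrA.
apply: IH => [y yt yz|ax axl]; last by apply: Hl; rewrite inE axl orbT.
by rewrite /s1 !updateE (negbTE yz) (negbTE yt) agree.
Qed.

Definition scale (z : reg) (a : F) (x : reg) : prog F :=
  Seq (Const scratch a) (Arith OpMul z scratch x).

Lemma within_scale z a x s :
  x != scratch -> z != scratch ->
  within 1 (scale z a x) s
    (fun s' => s' z = a * s x /\
       forall y, y != scratch -> y != z -> s' y = s y).
Proof.
move=> xt zt; rewrite -[1%N]add0n; apply/within_seq/within_const.
apply: within_arith; first by [].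
rewrite !updateE !eqxx (negbTE xt); split=> // y yt yz.
by rewrite !updateE (negbTE yz) (negbTE yt).
Qed.

End Programs.

(** * Banded Gaussian elimination *)

Section BandSolver.
Variables (F : fieldType) (n b : nat).
Implicit Types (s : store F).

(** Registers outside the band have arbitrary contents and stand for 0. *)
Definition band s (i l : nat) : F :=
  if (`|i - l| <= b)%N then s (Mat i l) else 0.

Definition row_reg (i : nat) (z : reg) : bool :=
  match z with Mat i1 _ => i1 == i | Rhs i1 => i1 == i | _ => false end.

(** Row i ends at column i + b.  Since i < i' <= j + b, the columns j + 1 to
    i + b lie inside the band of row i', so the update creates no fill-in. *)
Definition elim_row (j i i' : nat) : prog F :=
  Seq (Arith OpDiv (Tmp [:: 0%N]) (Mat i' j) (Mat i j))
    (Seq (\big[@Seq F/Skip]_(l <- iota j.+1 (i + b - j))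
            Seq (Arith OpMul scratch (Tmp [:: 0%N]) (Mat i l))
                (Arith OpSub (Mat i' l) (Mat i' l) scratch))
       (Seq (Arith OpMul scratch (Tmp [:: 0%N]) (Rhs i))
            (Arith OpSub (Rhs i') (Rhs i') scratch))).

Definition elim_val s (j i i' : nat) (z : reg) : F :=
  let f := s (Mat i' j) / s (Mat i j) in
  match z with
  | Mat i1 l => if (j < l <= i + b)%N then s z - f * s (Mat i l) else s z
  | Rhs i1 => s z - f * s (Rhs i)
  | _ => s z
  end.

Lemma within_elim_row j i i' s :
  s (Mat i j) != 0 -> i' != i -> (i <= j + b)%N ->
  within (4 * b + 3) (elim_row j i i') s (fun s' => forall z, ~~ is_tmp z ->
    s' z = if row_reg i' z then elim_val s j i i' z else s z).
Proof.
move=> nz ne ij.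
have -> : (4 * b + 3 = 1 + (4 * b + 2))%N by lia.
apply: within_seq; apply: within_arith; first by rewrite /= (negbTE nz).
set f := s (Mat i' j) / s (Mat i j); set s1 := update _ _ _.
have s1E z : ~~ is_tmp z -> s1 z = s z.
  by move=> zt; rewrite /s1 updateE; case: eqP zt => // ->.
have s1f : s1 (Tmp [:: 0%N]) = f by rewrite /s1 updateE eqxx.
move: s1 s1E s1f => s1 s1E s1f.
apply: within_seq.
apply: (within_weaken (@within_assign _ _ (iota j.+1 (i + b - j)) _ 2
  (Mat i') (pred1 scratch) (fun l => s (Mat i' l) - f * s (Mat i l)) s1
  (iota_uniq _ _) _ _ _)) => //.
- by move=> l1 l2 _ _ [].
- move=> l s2 il agree; rewrite -[2%N]/(1 + 1)%N.
  have agr y : y != scratch -> row_reg i' y = false -> s2 y = s1 y.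
    move=> yt yr; apply: agree => //= l' _ _.
    by apply/eqP => e; move: yr; rewrite e /= eqxx.
  apply: within_seq; apply: within_arith; first by [].
  apply: within_arith; first by [].
  rewrite !updateE /= !eqxx agr // s1f agr ?s1E /= //; last first.
    by apply/negbTE; rewrite eq_sym.
  rewrite agree //=; last first.
    by move=> l' _ l'l; apply/eqP => -[e]; rewrite e eqxx in l'l.
  rewrite ifN ?s1E //; split=> // y yt ym.
  by rewrite !updateE (negbTE yt) (negbTE ym).
- rewrite size_iota; lia.
move=> s2 [Hm Ho].
rewrite -[2%N]/(1 + 1)%N.
apply: within_seq; apply: within_arith; first by [].
apply: within_arith; first by [].
rewrite !updateE /= eqxx.
have s2R k : s2 (Rhs k) = s (Rhs k) by rewrite Ho ?s1E.
have s2f : s2 (Tmp [:: 0%N]) = f by rewrite Ho // s1f.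
have eS : (Rhs i' == scratch) = false by apply/negbTE.
rewrite s2f !s2R eS => z zt; rewrite !updateE.
case: z zt => //= [k _|k x y _|k x _|k l _|k _|k _|k _|k _].
- by rewrite !ifN ?Ho ?s1E.
- by rewrite !ifN ?Ho ?s1E.
- by rewrite !ifN ?Ho ?s1E.
- rewrite ifN // ifN //; case: (eqVneq k i') => [->|ki]; last first.
    rewrite Ho ?s1E // => l' _; apply/eqP => -[e].
    by rewrite e eqxx in ki.
  case: ifP => jl; first by rewrite Hm // mem_iota; lia.
  rewrite Ho ?s1E // => l'; rewrite mem_iota => l'i.
  by apply/eqP => -[e]; move: jl l'i; rewrite e; lia.
- by rewrite !ifN ?Ho ?s1E.
- have -> : (Rhs k == Rhs i') = (k == i') by apply/eqP/eqP => [[]|->].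
  by rewrite [Rhs k == scratch](introF eqP) ?s2R //; case: eqVneq => // ->.
- by rewrite !ifN ?Ho ?s1E.
- by rewrite !ifN ?Ho ?s1E.
Qed.

Definition eliminate (j i : nat) (rows : seq nat) : prog F :=
  \big[@Seq F/Skip]_(i' <- rows) elim_row j i i'.

Lemma within_eliminate j i rows s :
  s (Mat i j) != 0 -> i \notin rows -> uniq rows -> (i <= j + b)%N ->
  within (size rows * (4 * b + 3)) (eliminate j i rows) s
    (fun s' => forall z, ~~ is_tmp z ->
       (forall i', i' \in rows -> row_reg i' z -> s' z = elim_val s j i i' z) /\
       ((forall i', i' \in rows -> ~~ row_reg i' z) -> s' z = s z)).
Proof.
move=> nz ni ur ij.
apply: within_par => // [i1 i2 z _ _|i' s1 ir agree].
  by case: z => //= [? ?|?] /eqP-> /eqP.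
have ne : i' != i by apply: contraNneq ni => <-.
have agr z : ~~ is_tmp z -> row_reg i z \/ row_reg i' z -> s1 z = s z.
  move=> zt H; apply: agree => // k kr ki'.
  case: H => H; apply/negP; case: z zt H => //= [i1 l|i1] _ /eqP-> /eqP e.
  - by rewrite e kr in ni.
  - by rewrite e kr in ni.
  - by rewrite e eqxx in ki'.
  - by rewrite e eqxx in ki'.
have e1 l : s1 (Mat i l) = s (Mat i l) by apply: agr => //; left; rewrite /= eqxx.
have e2 l : s1 (Mat i' l) = s (Mat i' l).
  by apply: agr => //; right; rewrite /= eqxx.
have r1 : s1 (Rhs i) = s (Rhs i) by apply: agr => //; left; rewrite /= eqxx.
have r2 : s1 (Rhs i') = s (Rhs i') by apply: agr => //; right; rewrite /= eqxx.
apply: (within_weaken (@within_elim_row j i i' s1 _ ne ij)) => //.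
  by rewrite e1.
move=> s2 H2 z zt; rewrite H2 //; case: ifP => // rz.
rewrite /elim_val e1 e2.
by case: z zt rz => //= [k l|k] _ /eqP->; rewrite ?e1 ?e2 ?r1 ?r2.
Qed.

Definition back_subst (j i : nat) : prog F :=
  Seq (Move (Sol j) (Rhs i))
    (Seq (\big[@Seq F/Skip]_(l <- [seq l <- iota j.+1 (i + b - j) | (l < n)%N])
            Seq (Arith OpMul scratch (Mat i l) (Sol l))
                (Arith OpSub (Sol j) (Sol j) scratch))
       (Arith OpDiv (Sol j) (Sol j) (Mat i j))).

(** The loop of [back_subst] visits only the part of row i inside the band; the
    rest of the row contributes 0. *)
Lemma sum_band s i j (y : nat -> F) : (j <= i + b)%N -> (i <= j + b)%N ->
  \sum_(l <- [seq l <- iota j.+1 (i + b - j) | (l < n)%N]) s (Mat i l) * y l =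
  \sum_(j.+1 <= l < n) band s i l * y l.
Proof.
move=> ji ij.
rewrite [RHS](bigID (fun l => l <= i + b)%N) /= [X in _ = _ + X]big1 ?addr0; last first.
  by move=> l li; rewrite /band ifF ?mul0r //; lia.
rewrite -[RHS]big_filter.
have E : perm_eq [seq l <- iota j.+1 (i + b - j) | (l < n)%N]
    [seq l <- index_iota j.+1 n | (l <= i + b)%N].
  apply: uniq_perm; rewrite ?filter_uniq ?iota_uniq // => l.
  by rewrite !mem_filter mem_index_iota mem_iota; lia.
rewrite (perm_big _ E) /=; apply: eq_big_seq => l.
by rewrite mem_filter mem_index_iota /band => H; rewrite ifT //; lia.
Qed.

Lemma within_back_subst j i s :
  (j <= i + b)%N -> (i <= j + b)%N -> s (Mat i j) != 0 ->
  within (4 * b + 1) (back_subst j i) s (fun s' =>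
    s' (Sol j) = (s (Rhs i) - \sum_(j.+1 <= l < n) band s i l * s (Sol l))
                   / s (Mat i j) /\
    forall z, z != scratch -> z != Sol j -> s' z = s z).
Proof.
move=> ji ij nz; rewrite -(@sum_band s) // /back_subst.
set ls := [seq l <- _ | _].
have szl : (size ls <= 2 * b)%N.
  by rewrite size_filter (leq_trans (count_size _ _)) // size_iota; lia.
apply: (@within_weaken _ (0 + (2 * size ls + 1))%N _ _ _ _ _ _ _ (fun s' H => H));
  last by lia.
apply/within_seq/within_move; apply: within_seq.
set s1 := update _ _ _.
apply: (@within_weaken _ _ _ _ _ (fun s' =>
    s' (Sol j) = s1 (Sol j) - \sum_(l <- ls) s (Mat i l) * s (Sol l) /\
    forall z, z != scratch -> z != Sol j -> s' z = s z)) (leqnn _) _; last first.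
  move=> s2 [H1 H2]; apply: within_arith.
    by rewrite /= H2 // (negbTE nz).
  rewrite updateE eqxx H1 /s1 updateE eqxx; split=> // z zt zS.
  by rewrite updateE (negbTE zS) H2.
have : forall l, l \in ls -> l != j.
  by move=> l; rewrite mem_filter mem_iota; lia.
have : forall z, z != scratch -> z != Sol j -> s1 z = s z.
  by move=> z _ zS; rewrite /s1 updateE (negbTE zS).
elim: ls s1 {szl} => [|l ls IH] s1 agree lj.
  by rewrite !big_nil subr0 muln0; apply: within_skip.
rewrite !big_cons /= mulnS -[2%N]/(1 + 1)%N.
apply: within_seq; apply: within_seq.
apply: within_arith; first by [].
apply: within_arith; first by [].
rewrite !updateE /= eqxx.
have Sl : Sol l != Sol j.
  by apply/eqP => -[e]; move: (lj l); rewrite mem_head e eqxx => /(_ isT).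
rewrite (agree (Mat i l)) // (agree (Sol l)) //.
set s2 := update _ (Sol j) _.
rewrite opprD addrA.
have -> : s1 (Sol j) - s (Mat i l) * s (Sol l) = s2 (Sol j).
  by rewrite /s2 updateE eqxx ifN.
apply: IH => [z zt zS|l' l'l]; last by apply: lj; rewrite inE l'l orbT.
by rewrite /s2 !updateE (negbTE zt) (negbTE zS) agree.
Qed.

(** The continuation [some] receives the pivot row together with the rows after
    it: the rows before it have just been found to vanish in column j, so that
    only those after it remain to be eliminated. *)
Fixpoint pivot_search (j : nat) (none : prog F)
    (some : nat -> seq nat -> prog F) (rows : seq nat) : prog F :=
  if rows is i :: rows' then
    IfZero (Mat i j) (pivot_search j none some rows') (some i rows')
  else none.

Lemma within_pivot_search j none some rows c s Q :
  ((forall i, i \in rows -> s (Mat i j) = 0) -> within c none s Q) ->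
  (forall r1 i r2, rows = r1 ++ i :: r2 ->
     (forall i', i' \in r1 -> s (Mat i' j) = 0) -> s (Mat i j) != 0 ->
     within c (some i r2) s Q) ->
  within (size rows + c) (pivot_search j none some rows) s Q.
Proof.
elim: rows => [|i rows IH] /= Hn Hs; first exact: Hn.
rewrite addSn; apply: within_ifzero => [i0|i0].
  apply: IH => [H|r1 k r2 e H nz].
    by apply: Hn => k; rewrite inE => /orP[/eqP->//|]; exact: H.
  apply: (Hs (i :: r1) k r2); rewrite ?e //.
  by move=> k'; rewrite inE => /orP[/eqP->//|]; exact: H.
have [m [s' [r l H]]] : within c (some i rows) s Q by apply: (Hs [::] i rows).
by exists m, s'; split=> //; lia.
Qed.

(** S lists the rows that have not yet served as a pivot, in increasing order,
    and j = n - t is the current column.  Rows need not be moved, since a pivot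
    row is simply dropped from S.  The unknown j is computed after the recursive
    call has determined the later ones: the recursion performs the back
    substitution. *)
Fixpoint band_solve (t : nat) (S : seq nat) : prog F :=
  if t is t'.+1 then
    let j := (n - t)%N in
    pivot_search j
      (Seq (Const (Sol j) 0) (band_solve t' S))
      (fun i rows => Seq (eliminate j i rows)
         (Seq (band_solve t' (rem i S)) (back_subst j i)))
      [seq i <- S | (j <= i + b) && (i <= j + b)]%N
  else Skip.

(** At most 2 b + 1 tests for zero, 2 b + 1 eliminations of a row and one back
    substitution. *)
Definition column_cost := ((2 * b + 1) * (4 * b + 4) + (4 * b + 1))%N.

(** The invariant is that the rows of S, restricted to the columns from j on,
    form a consistent system.  Elimination only replaces equations by equivalent
    ones, and preserves the shape of the band because the pivot is the smallest
    row that can be chosen. *)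
Lemma within_band_solve t S s :
  (t <= n)%N -> sorted ltn S ->
  (exists x : nat -> F, forall i, i \in S ->
     \sum_(n - t <= l < n) band s i l * x l = s (Rhs i)) ->
  within (t * column_cost) (band_solve t S) s (fun s' =>
    (forall i, i \in S ->
       \sum_(n - t <= l < n) band s i l * s' (Sol l) = s (Rhs i)) /\
    (forall z, ~~ is_tmp z -> (forall i, i \in S -> ~~ row_reg i z) ->
       (forall l, (n - t <= l)%N -> z != Sol l) -> s' z = s z)).
Proof.
elim: t S s => [|t IH] S s tn sS [x Hx].
  by apply: within_skip; split=> // i /Hx <-; rewrite subn0 !big_geq.
rewrite /= mulSn; set j := (n - t.+1)%N.
have nt : (n - t = j.+1)%N by rewrite /j; lia.
have jn : (j < n)%N by rewrite /j; lia.
set rows := [seq i <- S | _].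
have uS : uniq S by apply: sorted_uniq sS; [exact: ltn_trans | exact: ltnn].
have szr : (size rows <= 2 * b + 1)%N.
  have := @uniq_leq_size _ rows (iota (j - b) (2 * b + 1)).
  rewrite size_iota filter_uniq //; apply=> // i.
  by rewrite mem_filter mem_iota; lia.
have sr : sorted ltn rows by apply: sorted_filter => //; exact: ltn_trans.
pose c := ((2 * b + 1) * (4 * b + 3) + (t * column_cost + (4 * b + 1)))%N.
apply: (@within_weaken _ (size rows + c)%N _ _ _ _ _ _ _ (fun s' H => H));
  last first.
  apply: leq_trans (leq_add szr (leqnn _)) _; rewrite /c; set u := (t * _)%N.
  by rewrite /column_cost; lia.
apply: within_pivot_search => [H0|r1 i r2 er H0 nz].
  (* No pivot: column j vanishes on S, so the unknown j can be set to 0. *)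
  have c0 i : i \in S -> band s i j = 0.
    move=> iS; rewrite /band; case: ifP => // ij; apply: H0.
    by rewrite mem_filter iS andbT; lia.
  apply: (@within_weaken _ (0 + t * column_cost)%N _ _ _ _ _ _ _ (fun s' H => H));
    last by rewrite /c; lia.
  apply/within_seq/within_const; set s1 := update _ _ _.
  have s1E z : z != Sol j -> s1 z = s z by move=> zS; rewrite /s1 updateE (negbTE zS).
  have b1 i l : band s1 i l = band s i l by rewrite /band s1E.
  apply: (within_weaken (IH S s1 _ sS _)) => //.
  - by lia.
  - exists x => i iS; rewrite nt s1E // -(Hx i iS) [RHS]big_ltn // c0 // mul0r add0r.
    by apply: eq_bigr => l _; rewrite b1.
  move=> s2 [H1 H2]; split=> [i iS|z zt zr zs].
    rewrite big_ltn // c0 // mul0r add0r -(s1E (Rhs i)) // -H1 // nt.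
    by apply: eq_bigr => l _; rewrite b1.
  rewrite H2 //; last by move=> l; rewrite nt => jl; apply: zs; lia.
  by rewrite s1E // zs.
have : i \in rows by rewrite er mem_cat mem_head orbT.
rewrite mem_filter => /andP[/andP[ji ij] iS].
have Hr2 i' : i' \in r2 = (i' \in rows) && (i < i')%N.
  move: sr; rewrite er (sorted_pairwise ltn_trans) pairwise_cat /=.
  rewrite allrel_consr => /and4P[/andP[/allP h1 _] _ /allP h2 _].
  rewrite mem_cat inE.
  apply/idP/idP => [h|/andP[/orP[h|/orP[/eqP->|//]]]]; last by rewrite ltnn.
    by rewrite h (h2 _ h) !orbT.
  by have /= := h1 _ h; lia.
have Hr1 i' : i' \in rows -> (i' < i)%N -> s (Mat i' j) = 0.
  move: (Hr2 i'); rewrite er mem_cat inE => h /orP[/H0//|/orP[/eqP->|h2]].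
    by rewrite ltnn.
  by move: h; rewrite h2 !orbT => /esym /=; lia.
have remE : rem i S =i [predD1 S & i] by move=> k; rewrite mem_rem_uniq.
have ur2 : uniq r2.
  by move: (filter_uniq [pred i | (j <= i + b) && (i <= j + b)]%N uS);
     rewrite -/rows er cat_uniq /= => /and3P[_ _ /andP[]].
have sz2 : (size r2 <= 2 * b + 1)%N.
  by move: szr; rewrite er size_cat /=; lia.
apply: within_seq.
apply: (within_weaken (@within_eliminate j i r2 s nz _ ur2 ij)) => //.
- by rewrite Hr2 ltnn andbF.
- by rewrite leq_mul2r sz2 orbT.
move=> s1 Hs1.
(* The multiplier of row i', which is 0 for the rows that are not modified. *)
pose f i' := band s i' j / s (Mat i j).
have bij : band s i j = s (Mat i j) by rewrite /band ifT //; lia.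
have f0 i' : i' \in S -> i' != i -> i' \notin r2 -> f i' = 0.
  move=> i'S ne nr; rewrite /f /band; case: ifP => [h|]; last by rewrite mul0r.
  have i'r : i' \in rows by rewrite mem_filter i'S andbT; lia.
  by rewrite Hr1 ?mul0r //; move: nr; rewrite Hr2 i'r; lia.
have unt i' z : ~~ is_tmp z -> row_reg i' z -> i' \notin r2 -> s1 z = s z.
  move=> zt rz nr; have [_ -> //] := Hs1 z zt.
  move=> k kr; apply/negP; case: z zt rz => //= [k1 l|k1] _ /eqP-> /eqP e;
    by rewrite e kr in nr.
have A1 i' l : i' \in S -> i' != i -> (j < l)%N ->
    band s1 i' l = band s i' l - f i' * band s i l.
  move=> i'S ne jl; case: (boolP (i' \in r2)) => [ir|nr]; last first.
    by rewrite f0 // mul0r subr0 /band (unt i') //= eqxx.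
  have := ir; rewrite Hr2 mem_filter i'S andbT => /andP[/andP[ji' i'j] ii'].
  rewrite /band; case: ifP => h1; last by rewrite ifF ?mulr0 ?subrr //; lia.
  have [H1 _] := Hs1 (Mat i' l) isT; rewrite (H1 i' ir); last by rewrite /= eqxx.
  have ij' : (`|i' - j| <= b)%N by lia.
  rewrite /elim_val /f /band ij'.
  case: ifP => h2; case: ifP => h3 //; try lia.
  by rewrite mulr0 subr0.
have G1 i' : i' \in S -> i' != i -> s1 (Rhs i') = s (Rhs i') - f i' * s (Rhs i).
  move=> i'S ne; case: (boolP (i' \in r2)) => [ir|nr]; last first.
    by rewrite f0 // mul0r subr0 (unt i') //= eqxx.
  have [H1 _] := Hs1 (Rhs i') isT; rewrite (H1 i' ir); last by rewrite /= eqxx.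
  rewrite /elim_val /f /band ifT //.
  by move: ir; rewrite Hr2 mem_filter => /andP[/andP[/andP[]]]; lia.
have inr2 : i \notin r2 by rewrite Hr2 ltnn andbF.
have Ai l : s1 (Mat i l) = s (Mat i l) by rewrite (unt i) //= eqxx.
have Gi : s1 (Rhs i) = s (Rhs i) by rewrite (unt i) //= eqxx.
apply: within_seq.
apply: (within_weaken (IH (rem i S) s1 _ _ _)) => //.
- by lia.
- by apply: (subseq_sorted ltn_trans (rem_subseq _ _) sS).
- exists x => i'; rewrite remE !inE => /andP[ne i'S].
  rewrite nt G1 // -(Hx i' i'S) -(Hx i iS) [in RHS]big_ltn //.
  rewrite [in X in f i' * X]big_ltn // bij.
  rewrite (eq_big_nat _ _ (F2 := fun l => band s i' l * x l - f i' * (band s i l * x l))).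
    rewrite sumrB -mulr_sumr mulrDr.
    have -> : f i' * (s (Mat i j) * x j) = band s i' j * x j.
      by rewrite mulrA /f divfK.
    by rewrite opprD addrACA subrr add0r.
  by move=> l /andP[jl _]; rewrite A1 // mulrBl mulrA.
move=> s2 [H1 H2].
have s2i z : ~~ is_tmp z -> row_reg i z -> s2 z = s z.
  move=> zt rz; rewrite H2 ?(unt i) //.
    move=> k; rewrite remE !inE => /andP[ki _]; apply/negP.
    by case: z zt rz => //= [k1 l|k1] _ /eqP-> /eqP e; rewrite e eqxx in ki.
  by move=> l _; case: z zt rz.
have ri l : row_reg i (Mat i l) by rewrite /= eqxx.
apply: (within_weaken (@within_back_subst j i s2 ji ij _)) => //.
  by rewrite s2i.
move=> s3 [H3 H4]; split; last first.
  move=> z zt zr zs; rewrite H4 ?zs //; last by case: z zt {zr zs}.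
  rewrite H2 //.
  - have [_ -> //] := Hs1 z zt.
    by move=> k; rewrite Hr2 mem_filter => /andP[/andP[_ kS] _]; exact: zr.
  - by move=> k; rewrite remE !inE => /andP[_ kS]; exact: zr.
  - by move=> l; rewrite nt => jl; apply: zs; lia.
have s3S l : (j < l)%N -> s3 (Sol l) = s2 (Sol l).
  by move=> jl; rewrite H4 //; apply/eqP => -[e]; rewrite e ltnn in jl.
have b2 l : band s2 i l = band s i l by rewrite /band s2i.
have Hi : \sum_(j <= l < n) band s i l * s3 (Sol l) = s (Rhs i).
  rewrite big_ltn // H3 bij !s2i ?ri //= ?eqxx // mulrC divfK //.
  rewrite (eq_big_nat _ _ (F2 := fun l => band s i l * s3 (Sol l))) ?subrK //.
  by move=> l /andP[jl _]; rewrite b2 s3S.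
move=> i' i'S; case: (eqVneq i' i) => [->//|ne].
have := H1 i'; rewrite remE !inE ne i'S => /(_ isT).
rewrite G1 // nt => /eqP; rewrite eq_sym subr_eq => /eqP->.
rewrite -Hi [in LHS]big_ltn // [in X in f i' * X]big_ltn // bij.
rewrite mulrDr mulrA divfK // addrCA; congr (_ + _).
rewrite mulr_sumr -big_split /=; apply: eq_big_nat => l /andP[jl _].
by rewrite A1 // s3S // mulrBl mulrA subrK.
Qed.

End BandSolver.

(** * Cosine sums and Chebyshev polynomials *)

Section Trapezoid.
Variables (R : realType) (nu : nat).
Local Notation N := nu.+1.

(** The collocation point number k is the cosine of this angle. *)
Definition node (k : nat) : R := k%:R * pi / N%:R.

(** The DCT-I of a vector is a family of trapezoidal sums: these are the weights
    of the trapezoidal rule on nu + 2 equidistant nodes. *)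
Definition trap_weight (k : nat) : R :=
  if (k == 0%N) || (k == N) then 2^-1 else 1.

Lemma trap_weight_gt0 k : 0 < trap_weight k.
Proof. by rewrite /trap_weight; case: ifP => _; rewrite ?invr_gt0 // ltr0n. Qed.

Lemma trapezoidE (f : nat -> R) :
  \sum_(k < N.+1) trap_weight k * f k = \sum_(k < N) (f k + f k.+1) / 2.
Proof.
transitivity (\sum_(k < N) f k / 2 + \sum_(k < N) f k.+1 / 2); last first.
  by rewrite -big_split /=; apply: eq_bigr => k _; rewrite mulrDl.
rewrite big_ord_recl big_ord_recr /= [X in _ = X + _]big_ord_recl.
rewrite [X in _ = _ + X]big_ord_recr /= /trap_weight /= eqxx.
rewrite (_ : \sum_(i < nu) _ = \sum_(i < nu) f (lift ord0 i) / 2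
                             + \sum_(i < nu) f i.+1 / 2); last first.
  rewrite -big_split /=; apply: eq_bigr => k _.
  rewrite -mulrDl ifF; last by apply/negbTE; have := ltn_ord k; rewrite /bump /=; lia.
  by rewrite /bump /= add1n; field.
by rewrite /bump /= add1n; field.
Qed.

(** The factor sin (phi / 2) makes the sum telescope:
    (cos a + cos (a + phi)) sin (phi / 2) =
    cos (phi / 2) (sin (a + phi) - sin a). *)
Lemma cos_sum_telescope (phi : R) n :
  (\sum_(k < n) (cos (k%:R * phi) + cos (k.+1%:R * phi)) / 2) * sin (phi / 2) =
  cos (phi / 2) * sin (n%:R * phi) / 2.
Proof.
elim: n => [|n IH]; first by rewrite big_ord0 mul0r mul0r sin0 mulr0 mul0r.
rewrite big_ord_recr /= mulrDl IH.
have -> : n.+1%:R * phi = n%:R * phi + phi / 2 *+ 2.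
  by rewrite -natr1; field.
rewrite sinD cosD sin_mulr2n cos_mulr2n.
have := sin2cos2 (phi / 2); set s := sin (_ / _); set c := cos (_ / _).
set C := cos _; set S := sin _ => e.
transitivity (c * S / 2 + C * c ^+ 2 * s - S * c * s ^+ 2); first by field.
by rewrite e; field.
Qed.

Lemma sinD_natpi (x : R) q : sin (x + q%:R * pi) = (-1) ^+ q * sin x.
Proof. by rewrite mulr_natl; apply: alternatingn; exact: sinDpi. Qed.

Lemma cos_natpi q : cos (q%:R * pi) = (-1) ^+ q :> R.
Proof.
rewrite mulr_natl -[pi *+ q]add0r (alternatingn (@cosDpi R)).
by rewrite cos0 mulr1.
Qed.

(** Half the node a is a pi / (2 N): up to multiples of pi, it lies strictly
    between 0 and pi. *)
Lemma sin_node_half a : ~~ (2 * N %| a)%N -> sin (node a / 2) != 0.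
Proof.
move=> ndv; rewrite /node {1}(divn_eq a (2 * N)).
set q := (a %/ _)%N; set r := (a %% _)%N.
have r0 : (0 < r)%N by rewrite lt0n.
have rN : (r < 2 * N)%N by rewrite ltn_mod.
have N0 : N%:R != 0 :> R by rewrite pnatr_eq0.
have -> : (q * (2 * N) + r)%:R * pi / N%:R / 2 =
    r%:R / (2 * N%:R) * pi + q%:R * pi :> R.
  rewrite natrD !natrM; field; by rewrite nat1r.
rewrite sinD_natpi mulf_neq0 ?signr_eq0 // gt_eqF // sin_gt0_pi //.
have NN : 0 < 2 * N%:R :> R by rewrite -natrM ltr0n.
apply/andP; split.
  by rewrite mulr_gt0 ?pi_gt0 // divr_gt0 // ltr0n.
rewrite gtr_pMl ?pi_gt0 // ltr_pdivrMr // mul1r -natrM ltr_nat //.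
Qed.

(** Discrete orthogonality.  Multiplied by sin (node a / 2), which is nonzero, the
    sum telescopes to a multiple of sin (a pi) = 0. *)
Lemma trapezoid_cos_nat a : ~~ (2 * N %| a)%N ->
  \sum_(k < N.+1) trap_weight k * cos (a%:R * node k) = 0.
Proof.
move=> ndv; rewrite (trapezoidE (fun k => cos (a%:R * node k))).
have e k : a%:R * node k = k%:R * node a by rewrite /node; ring.
apply: (mulIf (sin_node_half ndv)); rewrite mul0r.
under eq_bigr do rewrite !e.
rewrite cos_sum_telescope.
have -> : N%:R * node a = 0 + a%:R * pi.
  by rewrite add0r /node mulrC divfK // pnatr_eq0.
by rewrite sinD_natpi sin0 !mulr0 mul0r.
Qed.

Lemma trapezoid_cos (a : int) : ~~ (2 * N %| `|a|)%N ->
  \sum_(k < N.+1) trap_weight k * cos (a%:~R * node k) = 0.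
Proof.
move=> ndv; rewrite -[RHS](trapezoid_cos_nat ndv); apply: eq_bigr => k _; congr (_ * _).
by case: a {ndv} => n //=; rewrite NegzE mulrNz mulNr cosN.
Qed.

Definition cos_moment (m i : nat) (l : int) : R :=
  \sum_(k < N.+1) trap_weight k * cos (m%:R * node k) * cos (node k) ^+ i
    * cos (l%:~R * node k).

(** A factor cos x shifts the frequency l by one in both directions, so i factors
    produce frequencies at distance at most i from l.  Orthogonality kills each
    of them unless it agrees with m or - m modulo 2 N. *)
Lemma cos_moment_eq0 m i l :
  (forall l' : int, (`|l' - l| <= i)%N ->
     ~~ (2 * N %| absz (m%:Z + l')%R)%N /\ ~~ (2 * N %| absz (m%:Z - l')%R)%N) ->
  cos_moment m i l = 0.
Proof.
elim: i l => [|i IH] l H.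
  have [h1 h2] : ~~ (2 * N %| absz (m%:Z + l)%R)%N /\
                 ~~ (2 * N %| absz (m%:Z - l)%R)%N by apply: H; lia.
  transitivity (\sum_(k < N.+1)
     (trap_weight k * cos ((m%:Z + l)%:~R * node k) / 2 +
      trap_weight k * cos ((m%:Z - l)%:~R * node k) / 2)).
    apply: eq_bigr => k _; rewrite expr0 mulr1.
    by rewrite intrD intrB !mulrDl cosD mulNr cosB -!pmulrn; field.
  by rewrite big_split /= -!mulr_suml !trapezoid_cos // !mul0r addr0.
transitivity (cos_moment m i (l + 1) / 2 + cos_moment m i (l - 1) / 2).
  rewrite /cos_moment !mulr_suml -big_split /=; apply: eq_bigr => k _.
  rewrite intrD intrB !mulrDl mulNr mul1r cosD cosB exprSr.
  by field.
rewrite !IH ?mul0r ?addr0 // => l' hl'; apply: H; lia.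
Qed.

(** The frequencies that the grid cannot distinguish from m are the images of m
    under the reflections at 0 and at N.  For n between 0 and N, none of these
    images is closer to n than m itself. *)
Lemma reflection_bound (m n : nat) (l : int) : (m <= N)%N -> (n <= N)%N ->
  (`|l - n| < `|m - n|)%N ->
  ~~ (2 * N %| absz (m%:Z + l)%R)%N /\ ~~ (2 * N %| absz (m%:Z - l)%R)%N.
Proof.
move=> mN nN H.
have ndv (a : int) : (a != 0) -> (`|a| < 2 * N)%N -> ~~ (2 * N %| `|a|)%N.
  by move=> a0 ?; apply/negP => /dvdn_leq; rewrite absz_gt0 a0 => /(_ isT); lia.
by split; apply: ndv; lia.
Qed.

Lemma cos_moment_far (m n i : nat) : (m <= N)%N -> (n <= N)%N ->
  (i < `|m - n|)%N -> cos_moment m i n = 0.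
Proof.
move=> mN nN H; apply: cos_moment_eq0 => l' hl'.
by apply: (@reflection_bound m n) => //; exact: leq_ltn_trans H.
Qed.

Definition dct_coef (m n : nat) : R :=
  if n == 0%N then 2^-1
  else if n == N then (-1) ^+ m / 2
  else cos ((m * n)%:R * pi / N%:R).

Lemma dct1E (m n : 'I_nu.+2) : dct1 R nu m n = (dct_coef m n)%:C.
Proof. by rewrite mxE. Qed.

Lemma dct_coefE m n : dct_coef m n = trap_weight n * cos (m%:R * node n).
Proof.
rewrite /dct_coef /trap_weight /node; case: (eqVneq n 0%N) => [->|n0] /=.
  by rewrite !mul0r mulr0 cos0 mulr1.
case: (eqVneq n N) => [->|nN] /=; last by rewrite mul1r natrM !mulrA.
have N0 : N%:R != 0 :> R by rewrite pnatr_eq0.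
by rewrite mulrAC divff // mul1r cos_natpi mulrC.
Qed.

(** The bandedness behind the whole method: the product of T_n with a polynomial
    of degree less than |m - n| has no component along T_m, even after
    aliasing. *)
Lemma dct_poly_far (m n : nat) (p : {poly R[i]}) :
  (m <= N)%N -> (n <= N)%N -> (size p <= `|m - n|)%N ->
  \sum_(k < N.+1) (dct_coef m k)%:C *
     (p.[(cos (node k))%:C] * (cos (n%:R * node k))%:C) = 0.
Proof.
move=> mN nN sp.
transitivity (\sum_(i < size p) p`_i * (cos_moment m i n)%:C).
  transitivity (\sum_(i < size p) \sum_(k < N.+1) p`_i * (trap_weight k *
     cos (m%:R * node k) * cos (node k) ^+ i * cos (n%:~R * node k))%:C).
    rewrite exchange_big; apply: eq_bigr => k _ /=.
    rewrite horner_coef mulr_suml mulr_sumr; apply: eq_bigr => i _.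
    rewrite dct_coefE !rmorphM /= rmorphXn /= -pmulrn; ring.
  by apply: eq_bigr => i _; rewrite -mulr_sumr -rmorph_sum.
apply: big1 => i _; rewrite cos_moment_far ?rmorph0 ?mulr0 //.
exact: leq_trans sp.
Qed.

Lemma dct1_gram (m n : 'I_nu.+2) :
  (dct1 R nu *m dct1 R nu) m n =
  ((m == n)%:R * trap_weight n *
    \sum_(k < N.+1) trap_weight k * cos (m%:R * node k) ^+ 2)%:C.
Proof.
transitivity (trap_weight n * cos_moment m 0 n)%:C.
  rewrite mxE /cos_moment mulr_sumr rmorph_sum; apply: eq_bigr => k _.
  rewrite !dct1E -rmorphM; congr (_%:C); rewrite !dct_coefE expr0 -!pmulrn.
  have -> : k%:R * node n = n%:R * node k by rewrite /node; ring.
  by ring.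
case: (eqVneq m n) => [->|mn]; last first.
  rewrite !mul0r cos_moment_far ?mulr0 ?leq_ord //.
  by rewrite lt0n absz_eq0 subr_eq0 eqz_nat.
congr (_%:C); rewrite mul1r; congr (_ * _); apply: eq_bigr => k _.
by rewrite expr0 mulr1 -pmulrn -mulrA -expr2.
Qed.

(** By [dct1_gram], the square of the transform is diagonal with a positive
    diagonal. *)
Lemma dct1_inj q (v w : 'M[R[i]]_(nu.+2, q)) :
  dct1 R nu *m v = dct1 R nu *m w -> v = w.
Proof.
move=> e; have : dct1 R nu *m dct1 R nu *m v = dct1 R nu *m dct1 R nu *m w.
  by rewrite -!mulmxA e.
pose g (m : 'I_nu.+2) : R := trap_weight m *
    \sum_(k < N.+1) trap_weight k * cos (m%:R * node k) ^+ 2.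
have E u : dct1 R nu *m dct1 R nu *m u = \matrix_(m, j) ((g m)%:C * u m j).
  apply/matrixP => m j; rewrite [RHS]mxE [LHS]mxE (bigD1 m) //= big1 ?addr0.
    by rewrite dct1_gram eqxx mul1r.
  by move=> n nm; rewrite dct1_gram eq_sym (negbTE nm) !mul0r.
rewrite !E => /matrixP H; apply/matrixP => m j; have := H m j; rewrite !mxE.
apply: mulfI; rewrite (_ : 0 = 0%:C) // (inj_eq (@complexI _)) gt_eqF //.
rewrite mulr_gt0 ?trap_weight_gt0 // (bigD1 ord0) //= ltr_pwDl //.
  by rewrite /node !mul0r mulr0 cos0 expr1n mulr1 trap_weight_gt0.
by apply: sumr_ge0 => k _; rewrite mulr_ge0 ?sqr_ge0 // ltW ?trap_weight_gt0.
Qed.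

End Trapezoid.

Lemma chebTSS (F : nzRingType) n :
  chebT F n.+2 = 'X * chebT F n.+1 *+ 2 - chebT F n.
Proof. by []. Qed.

Lemma chebT_cos (R : realType) n (t : R) :
  (chebT R[i] n).[(cos t)%:C] = (cos (n%:R * t))%:C.
Proof.
suff: (chebT R[i] n).[(cos t)%:C] = (cos (n%:R * t))%:C /\
      (chebT R[i] n.+1).[(cos t)%:C] = (cos (n.+1%:R * t))%:C by case.
elim: n => [|n [IH1 IH2]].
  by rewrite hornerC hornerX mul0r cos0 mul1r.
split=> //; rewrite chebTSS hornerD hornerN hornerMn hornerM hornerX IH1 IH2.
rewrite -rmorphM -rmorphMn -rmorphB; congr (_%:C).
have -> : n.+2%:R * t = n.+1%:R * t + t by rewrite -[n.+2%:R]natr1 mulrDl mul1r.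
have -> : n%:R * t = n.+1%:R * t - t by rewrite -natr1 mulrDl mul1r addrK.
by rewrite cosB cosD; ring.
Qed.

(** With the factor 1 - x^2, differentiation couples T_n to its neighbours
    only. *)
Lemma chebT_deriv (F : comNzRingType) n :
  (1 - 'X^2) * (chebT F n)^`() = ('X * chebT F n - chebT F n.+1) *+ n.
Proof.
suff: (1 - 'X^2) * (chebT F n)^`() = ('X * chebT F n - chebT F n.+1) *+ n /\
  (1 - 'X^2) * (chebT F n.+1)^`() =
    ('X * chebT F n.+1 - chebT F n.+2) *+ n.+1 by case.
elim: n => [|n [IH1 IH2]].
  rewrite chebTSS /= derivC derivX mulr0; split=> //.
  by ring.
split=> //; rewrite [chebT F n.+3]chebTSS [in LHS]chebTSS.
rewrite derivB derivMn derivM derivX mulrBr IH1 mul1r.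
rewrite [in LHS]mulrnAr mulrDr mulrCA IH2 chebTSS.
move: (chebT F n.+1) (chebT F n) => A B.
by ring.
Qed.

(** * The fast Fourier transform *)

Section FFT.
Variable F : fieldType.
Implicit Types (s : store F).

(** The register names record the recursion of the Fourier transform: the data
    in the cells of p are split between the cells of 0 :: p and of 1 :: p, and
    the calls on these two halves work on disjoint sets of registers. *)
Definition cell (p : seq nat) (j : nat) : reg := Tmp (j :: p).

Definition below (p : seq nat) (y : reg) : Prop :=
  exists x q, y = Tmp (x :: q ++ p).

Fixpoint fft (K : nat) (p : seq nat) (z : F) : prog F :=
  if K is K'.+1 then
    Seq (\big[@Seq F/Skip]_(j <- iota 0 (2 ^ K'))
           Seq (Move (cell (0%N :: p) j) (cell p (2 * j)))
               (Move (cell (1%N :: p) j) (cell p (2 * j + 1))))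
   (Seq (fft K' (0%N :: p) (z ^+ 2))
   (Seq (fft K' (1%N :: p) (z ^+ 2))
        (\big[@Seq F/Skip]_(j <- iota 0 (2 ^ K'))
           Seq (scale scratch (z ^+ j) (cell (1%N :: p) j))
          (Seq (Arith OpAdd (cell p j) (cell (0%N :: p) j) scratch)
               (Arith OpSub (cell p (j + 2 ^ K')) (cell (0%N :: p) j) scratch)))))
  else Skip.

Lemma cell_inj p : injective (cell p).
Proof. by move=> i j []. Qed.

Lemma cell_cons_neq p a i j : cell (a :: p) i != cell p j.
Proof. by apply/eqP => -[_ /(congr1 size)] /=; lia. Qed.

Lemma cell_below p j : below p (cell p j).
Proof. by exists j, [::]. Qed.

Lemma below_cons p a y : below (a :: p) y -> below p y.
Proof. by move=> [x [q ->]]; exists x, (rcons q a); rewrite cat_rcons. Qed.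

Lemma cell_nbelow_sibling p a b j : a != b -> ~ below (a :: p) (cell (b :: p) j).
Proof.
move=> ab [x [q [_ e]]]; have := congr1 size e; rewrite size_cat /=.
case: q e => [|y q] /= e; last lia.
by case: e => e; rewrite e eqxx in ab.
Qed.

Lemma sum_even_odd (f : nat -> F) h :
  \sum_(n < 2 * h) f n = \sum_(n < h) (f (2 * n)%N + f (2 * n + 1)%N).
Proof.
elim: h => [|h IH]; first by rewrite !big_ord0.
rewrite [RHS]big_ord_recr -IH (_ : (2 * h.+1 = (2 * h).+2)%N); last by lia.
by rewrite !big_ord_recr /= -addrA addn1.
Qed.

(** The even and the odd terms of a Fourier sum of length 2 h are Fourier sums
    of length h for z^2.  Shifting j by h leaves both unchanged, and changes the
    sign of the factor z^j of the odd part. *)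
Lemma butterfly (z : F) h (x : nat -> F) j : z ^+ h = -1 ->
  let E := \sum_(n < h) (z ^+ 2) ^+ (j * n) * x (2 * n)%N in
  let O := \sum_(n < h) (z ^+ 2) ^+ (j * n) * x (2 * n + 1)%N in
  \sum_(n < 2 * h) z ^+ (j * n) * x n = E + z ^+ j * O /\
  \sum_(n < 2 * h) z ^+ ((j + h) * n) * x n = E - z ^+ j * O.
Proof.
move=> zh E O; split; rewrite (sum_even_odd (fun n => z ^+ (_ * n) * x n)).
  rewrite mulr_sumr -big_split /=; apply: eq_bigr => n _.
  rewrite mulrA -!exprM -exprD; congr (z ^+ _ * _ + z ^+ _ * _); lia.
rewrite mulr_sumr -sumrB; apply: eq_bigr => n _.
have e2 : z ^+ (2 * h) = 1 by rewrite mulnC exprM zh sqrrN expr1n.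
have -> : ((j + h) * (2 * n) = 2 * (j * n) + (2 * h) * n)%N by lia.
have -> : ((j + h) * (2 * n + 1) = j + 2 * (j * n) + h + (2 * h) * n)%N by lia.
rewrite -!exprM; move: (2 * (j * n))%N => e.
rewrite !exprD ![z ^+ (2 * h * _)]exprM e2 expr1n zh.
by ring.
Qed.

(** The cost satisfies c(K + 1) = 2 c(K) + 3 * 2^K. *)
Lemma within_fft K p z s :
  (forall k, K = k.+1 -> z ^+ (2 ^ k) = -1) ->
  within (2 * K * 2 ^ K) (fft K p z) s (fun s' =>
    (forall j, (j < 2 ^ K)%N ->
       s' (cell p j) = \sum_(n < 2 ^ K) z ^+ (j * n) * s (cell p n)) /\
    (forall y, y != scratch -> ~ below p y -> s' y = s y)).
Proof.
elim: K p z s => [|K IH] p z s Hz.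
  apply: within_skip; split=> // j; rewrite expn0 ltnS leqn0 => /eqP->.
  by rewrite big_ord1 mul0n expr0 mul1r.
have zh : z ^+ (2 ^ K) = -1 by apply: Hz.
have Hz2 k : K = k.+1 -> (z ^+ 2) ^+ (2 ^ k) = -1.
  by move=> e; rewrite -exprM -expnS -e.
set h := (2 ^ K)%N in zh *.
apply: (@within_weaken _ (h * 0 + (2 * K * h + (2 * K * h + h * 3)))%N
          _ _ _ _ _ _ _ (fun s' H => H)); last by rewrite expnS -/h; nia.
rewrite /= -/h.
apply: within_seq; rewrite -{1}(size_iota 0 h).
apply: (within_weaken (@within_par _ _ (iota 0 h) _ 0
  (fun j => pred2 (cell (0%N :: p) j) (cell (1%N :: p) j)) pred0
  (fun j y => if y == cell (0%N :: p) j then s (cell p (2 * j)%N)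
              else s (cell p (2 * j + 1)%N)) s (iota_uniq _ _) _ _)) => //.
- by move=> i j y _ _ /= /orP[]/eqP-> /orP[]/eqP[].
- move=> j s1 _ agree.
  have rd n : s1 (cell p n) = s (cell p n).
    by apply: agree => // i _ _ /=; rewrite ![cell p n == _]eq_sym
      !(negbTE (cell_cons_neq _ _ _ _)).
  rewrite -[0%N]/(0 + 0)%N; apply/within_seq/within_move/within_move.
  move=> y _; rewrite !updateE /= [cell p _ == _]eq_sym.
  rewrite (negbTE (cell_cons_neq _ _ _ _)) !rd.
  case: (eqVneq y (cell (1%N :: p) j)) => [->|_]; last by rewrite orbF; case: ifP.
  by rewrite orbT ifN //; apply/eqP => -[].
move=> s1 Hs1.
have s1c a j : (j < h)%N -> (a < 2)%N ->
    s1 (cell (a :: p) j) = s (cell p (2 * j + a)%N).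
  move=> jh a2; have [/(_ j) H _] := Hs1 (cell (a :: p) j) isT.
  rewrite H ?mem_iota //=.
    case: a a2 {H} => [|[|//]] _; first by rewrite eqxx addn0.
    by rewrite ifN //; apply/eqP => -[].
  by case: a a2 {H} => [|[|//]] _; rewrite eqxx ?orbT.
have s1o y : ~ below p y -> s1 y = s y.
  move=> nb; have [_ ->//] := Hs1 y isT => j _ /=.
  by apply/negP => /orP[]/eqP e; apply: nb; rewrite e; apply: below_cons (cell_below _ _).
apply: within_seq; apply: (within_weaken (IH _ _ s1 Hz2)) => // s2 [H2 F2].
apply: within_seq; apply: (within_weaken (IH _ _ s2 Hz2)) => // s3 [H3 F3].
rewrite -{1}(size_iota 0 h).
pose E j := s3 (cell (0%N :: p) j). pose O j := s3 (cell (1%N :: p) j).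
apply: (within_weaken (@within_par _ _ (iota 0 h) _ 3
  (fun j => pred2 (cell p j) (cell p (j + h)%N)) (pred1 scratch)
  (fun j y => if y == cell p j then E j + z ^+ j * O j else E j - z ^+ j * O j)
  s3 (iota_uniq _ _) _ _)) => //.
- move=> i j y; rewrite !mem_iota /= => ih jh /orP[]/eqP-> /orP[]/eqP/cell_inj; lia.
- move=> j s4; rewrite mem_iota => jh agree.
  have rd a : s4 (cell (a :: p) j) = s3 (cell (a :: p) j).
    by apply: agree => // i _ _ /=; rewrite !(negbTE (cell_cons_neq _ _ _ _)).
  rewrite -[3%N]/(1 + (1 + 1))%N; apply: within_seq.
  rewrite /scale -[1%N]/(0 + 1)%N; apply/within_seq/within_const.
  apply: within_arith; first by [].
  apply: within_seq; apply: within_arith; first by [].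
  apply: within_arith; first by [].
  rewrite !updateE !eqxx [cell (1%N :: p) j == scratch](introF eqP) //.
  rewrite [cell (0%N :: p) j == scratch](introF eqP) //.
  rewrite [scratch == cell p j](introF eqP) //.
  rewrite (negbTE (cell_cons_neq _ _ _ _)) !rd -/(E j) -/(O j) => y /= ys.
  rewrite !updateE (negbTE ys) /=.
  case: (eqVneq y (cell p (j + h)%N)) => [->|_]; last by rewrite orbF; case: ifP.
  rewrite orbT ifN //; apply/eqP => /cell_inj; lia.
move=> s4 Hs4.
have EE j : (j < h)%N ->
    E j = \sum_(n < h) (z ^+ 2) ^+ (j * n) * s (cell p (2 * n)%N).
  move=> jh; rewrite /E F3 //; last by apply: cell_nbelow_sibling.
  rewrite H2 //; apply: eq_bigr => n _; by rewrite s1c // addn0.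
have OO j : (j < h)%N ->
    O j = \sum_(n < h) (z ^+ 2) ^+ (j * n) * s (cell p (2 * n + 1)%N).
  move=> jh; rewrite /O H3 //; apply: eq_bigr => n _; rewrite F2 ?s1c //.
  by apply: cell_nbelow_sibling.
split=> [j|y ys nb]; last first.
  have [_ ->] := Hs4 y ys; last first.
    move=> j _; apply/negP => /orP[]/eqP e; apply: nb; rewrite e; exact: cell_below.
  rewrite F3 ?F2 ?s1o // => /below_cons; exact: nb.
rewrite expnS -/h => jh.
have nsc i : ~~ pred1 scratch (cell p i) by [].
have {Hs4} W4 i : (i < h)%N -> s4 (cell p i) = E i + z ^+ i * O i /\
    s4 (cell p (i + h)%N) = E i - z ^+ i * O i.
  move=> ih; have il : i \in iota 0 h by rewrite mem_iota.
  have [/(_ i il) H _] := Hs4 (cell p i) (nsc i).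
  have [/(_ i il) H' _] := Hs4 (cell p (i + h)%N) (nsc _).
  rewrite H ?H' /= ?eqxx ?orbT //; split=> //.
  by rewrite ifN //; apply/eqP => /cell_inj; lia.
case: (ltnP j h) => jh'.
  have [-> _] := W4 j jh'; rewrite EE // OO //.
  by have [-> _] := butterfly (fun n => s (cell p n)) j zh.
have jh2 : (j - h < h)%N by lia.
have [_] := W4 _ jh2; rewrite subnK // => ->; rewrite EE // OO //.
by have [_] := butterfly (fun n => s (cell p n)) (j - h) zh; rewrite subnK.
Qed.

(** The powers of a primitive root are distinct, so their Vandermonde matrix is
    invertible and every sequence of length L is a combination of geometric
    sequences. *)
Lemma fourier_interpolation (L : nat) (z : F) (t : nat -> F) :
  L.-primitive_root z ->
  exists tau : nat -> F, forall k, (k < L)%N ->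
    \sum_(a < L) z ^+ (k * a) * tau a = t k.
Proof.
move=> pz; pose V : 'M[F]_L := Vandermonde L (\row_(j < L) z ^+ j).
have uV : V \in unitmx.
  rewrite unitmxE det_Vandermonde unitfE; apply/prodf_neq0 => i _.
  apply/prodf_neq0 => j ij; rewrite !mxE subr_eq0 (eq_prim_root_expr pz).
  by rewrite !modn_small ?ltn_ord // neq_ltn ij orbT.
pose tau := invmx V *m \col_(k < L) t k.
exists (fun a => oapp (fun i => tau i 0) 0 (insub a)) => k kL.
have : V *m tau = \col_(k < L) t k by rewrite mulmxA mulmxV ?mul1mx.
move=> /matrixP/(_ (Ordinal kL) 0); rewrite [RHS]mxE mxE => <-.
apply: eq_bigr => a _; rewrite valK /=; congr (_ * _).
by rewrite !mxE mulnC exprM.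
Qed.

(** The order of z divides 2^(K + 1) but not 2^K. *)
Lemma primitive_root_pow2 (K : nat) (z : F) :
  (1 + 1 != 0 :> F) -> z ^+ (2 ^ K) = -1 -> (2 ^ K.+1).-primitive_root z.
Proof.
move=> two zK; have z1 : z ^+ (2 ^ K.+1) = 1.
  by rewrite expnSr exprM zK sqrrN expr1n.
have L0 : (0 < 2 ^ K.+1)%N by rewrite expn_gt0.
have [m pm] := prim_order_exists L0 z1.
move=> /(dvdn_pfactor _ _ (isT : prime 2))[e eK em].
suff -> : (K.+1 = e)%N by rewrite -em.
apply/eqP; rewrite eqn_leq eK andbT; apply: contraNT two => Ke.
have eK' : (e <= K)%N by rewrite leqNgt.
suff /eqP : z ^+ (2 ^ K) = 1 by rewrite zK -subr_eq0 -opprD oppr_eq0.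
apply/eqP; rewrite -(prim_order_dvd pm) em; exact: dvdn_exp2l.
Qed.

End FFT.

(** * The discrete cosine transform in O(n log n) *)

Section Cis.
Variable R : realType.

Definition cis (t : R) : R[i] := cos t +i* sin t.

Lemma cisD a b : cis (a + b) = cis a * cis b.
Proof.
by apply/eqP; rewrite eq_complex /= cosD sinD eqxx addrC eqxx.
Qed.

Lemma cis0 : cis 0 = 1.
Proof. by rewrite /cis cos0 sin0. Qed.

Lemma cisX t n : cis t ^+ n = cis (n%:R * t).
Proof.
elim: n => [|n IH]; first by rewrite expr0 mul0r cis0.
by rewrite exprSr IH -cisD -natr1 mulrDl mul1r.
Qed.

Lemma cis_neq0 t : cis t != 0.
Proof.
apply/eqP => e; have := cisD t (- t).
rewrite subrr cis0 e mul0r => /eqP; by rewrite oner_eq0.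
Qed.

Lemma cispi : cis pi = -1.
Proof. by rewrite /cis cospi sinpi; apply/eqP; rewrite eq_complex /= oppr0 !eqxx. Qed.

Lemma cos_cis t : (cos t)%:C = (cis t + cis (- t)) / 2.
Proof.
have -> : cis t + cis (- t) = (cos t)%:C * 2.
  rewrite mulr_natr mulr2n; apply/eqP.
  by rewrite eq_complex /= cosN sinN subrr addr0 !eqxx.
by rewrite mulfK ?pnatr_eq0.
Qed.

Lemma exists_pow2_root K : exists z : R[i], z ^+ (2 ^ K) = -1.
Proof.
elim: K => [|K [z zK]]; first by exists (-1).
by exists (sqrtc z); rewrite expnS exprM sqr_sqrtc.
Qed.

Variable nu : nat.
Local Notation N := nu.+1.

(** The index that the even extension of length 2 N reads at position j. *)
Definition fold_index (j : nat) : nat := if (j <= N)%N then j else (2 * N - j)%N.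

Lemma node_period m n : (n <= 2 * N)%N ->
  cis (m%:R * node R nu (2 * N - n)) = cis (- (m%:R * node R nu n)).
Proof.
move=> nN; have N0 : N%:R != 0 :> R by rewrite pnatr_eq0.
have -> : m%:R * node R nu (2 * N - n) =
    (2 * m)%:R * pi + - (m%:R * node R nu n) :> R.
  by rewrite /node natrB // !natrM; field; rewrite nat1r.
by rewrite cisD -cisX cispi exprM sqrrN !expr1n mul1r.
Qed.

(** The terms j and 2 N - j of the extension combine to a cosine, except at 0
    and N, which occur once: this is where the factors 1/2 of the DCT-I come
    from. *)
Lemma dct_even_extension (x : nat -> R[i]) m :
  \sum_(j < 2 * N) 2^-1 * cis (m%:R * node R nu j) * x (fold_index j) =
  \sum_(n < N.+1) (dct_coef R nu m n)%:C * x n.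
Proof.
pose g j := 2^-1 * cis (m%:R * node R nu j).
rewrite -(big_mkord xpredT (fun j => g j * x (fold_index j))).
rewrite -(big_mkord xpredT (fun n => (dct_coef R nu m n)%:C * x n)).
rewrite (@big_cat_nat _ _ _ N.+1) //=; last by lia.
have -> : \sum_(N.+1 <= j < 2 * N) g j * x (fold_index j) =
    \sum_(1 <= n < N) g (2 * N - n)%N * x n.
  rewrite big_nat_rev (_ : N.+1 = (1 + N)%N) // (_ : (2 * N = N + N)%N); last lia.
  rewrite big_addn addnK; apply: eq_big_nat => n /andP[n0 nN].
  rewrite /fold_index ifN; last by lia.
  congr (g _ * x _); lia.
have S f : \sum_(0 <= n < N.+1) f n = f 0%N + f N + \sum_(1 <= n < N) f n :> R[i].
  by rewrite big_nat_recr //= big_ltn // addrAC.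
rewrite !S.
have -> : g 0%N = (dct_coef R nu m 0)%:C.
  by rewrite /g /dct_coef /= /node !mul0r mulr0 cis0 mulr1 fmorphV rmorph_nat.
have -> : g N = (dct_coef R nu m N)%:C.
  have N0 : N%:R != 0 :> R by rewrite pnatr_eq0.
  rewrite /g /dct_coef /= eqxx /node mulrAC divff // mul1r -cisX cispi.
  by rewrite rmorphM fmorphV rmorph_nat rmorphXn rmorphN1 mulrC.
rewrite -addrA /fold_index leqnn /=; congr (_ + _); rewrite -big_split /=.
apply: eq_big_nat => n /andP[n0 nN].
rewrite ifT; last by lia.
rewrite -mulrDl; congr (_ * _); rewrite /g node_period; last by lia.
rewrite /dct_coef ifN; last by lia.
rewrite ifN; last by lia.
rewrite -mulrDr cos_cis mulrC natrM /node !mulrA //.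
Qed.

(** A root of unity of order 4 N raised to the square of k. *)
Definition chirp (k : nat) : R[i] := cis (pi / (2 * N%:R)) ^+ (k ^ 2).

Lemma chirp_neq0 k : chirp k != 0.
Proof. by rewrite expf_neq0 ?cis_neq0. Qed.

(** Since (m + j)^2 - m^2 - j^2 = 2 m j, the Fourier kernel is a function of
    m + j up to diagonal factors. *)
Lemma chirpD m j :
  chirp (m + j) / (chirp m * chirp j) = cis (m%:R * node R nu j).
Proof.
rewrite /chirp -exprD.
have -> : ((m + j) ^ 2 = m ^ 2 + j ^ 2 + 2 * (m * j))%N by lia.
rewrite exprD mulrAC divff ?expf_neq0 ?cis_neq0 // mul1r cisX; congr cis.
have N0 : N%:R != 0 :> R by rewrite pnatr_eq0.
rewrite /node !natrM; field; by rewrite nat1r.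
Qed.

(** Up to the diagonal factors of [chirpD], the DCT-I is a Hankel matrix with
    entries chirp (m + j).  All indices stay below 3 N <= L, so that chirp can be
    replaced by its interpolation, which separates m and j: the Hankel matrix is
    the product of a Fourier matrix, the diagonal tau and the same Fourier
    matrix. *)
Lemma bluestein (L : nat) (z : R[i]) (tau x : nat -> R[i]) m :
  (forall k, (k < L)%N -> \sum_(a < L) z ^+ (k * a) * tau a = chirp k) ->
  (3 * N <= L)%N -> (m <= N)%N ->
  (chirp m)^-1 * \sum_(a < L) z ^+ (m * a) * (tau a *
     \sum_(j < L) z ^+ (a * j) *
       (if (j < 2 * N)%N then 2^-1 / chirp j * x (fold_index j) else 0)) =
  \sum_(n < N.+1) (dct_coef R nu m n)%:C * x n.
Proof.
move=> Htau NL mN; rewrite -dct_even_extension.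
pose u j := if (j < 2 * N)%N then 2^-1 / chirp j * x (fold_index j) else 0.
transitivity ((chirp m)^-1 * \sum_(j < L) u j *
    \sum_(a < L) z ^+ ((m + j) * a) * tau a).
  congr (_ * _); under [RHS]eq_bigr do rewrite mulr_sumr.
  rewrite exchange_big; apply: eq_bigr => a _ /=.
  rewrite !mulr_sumr; apply: eq_bigr => j _; rewrite -/(u j).
  rewrite mulnDl exprD (mulnC j a); ring.
rewrite mulr_sumr -(big_mkord xpredT (fun j => (chirp m)^-1 * (u j *
    \sum_(a < L) z ^+ ((m + j) * a) * tau a))).
rewrite (@big_cat_nat _ _ _ (2 * N)) //=; last by lia.
rewrite [X in _ + X]big_nat_cond [X in _ + X]big1 => [|j]; last first.
  by rewrite andbT /u => /andP[jN _]; rewrite ifN ?mul0r ?mulr0 // -leqNgt.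
rewrite addr0 big_mkord; apply: eq_bigr => j _.
have jN := ltn_ord j.
rewrite Htau; last by lia.
rewrite /u jN -chirpD; field.
by rewrite !chirp_neq0.
Qed.

End Cis.

Section DctProgram.
Variables (R : realType) (nu : nat).
Local Notation N := nu.+1.
Local Notation prog := (prog R[i]).
Implicit Types (s : store R[i]).

Definition dct_block (K : nat) (z : R[i]) (tau : nat -> R[i]) (o : nat) : prog :=
  Seq (\big[@Seq _/Skip]_(j <- iota 0 (2 ^ K))
         if (j < 2 * N)%N
         then scale (cell [::] j) (2^-1 / chirp R nu j) (Val (o + fold_index nu j))
         else Const (cell [::] j) 0)
  (Seq (fft K [::] z)
  (Seq (\big[@Seq _/Skip]_(j <- iota 0 (2 ^ K))
          scale (cell [::] j) (tau j) (cell [::] j))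
  (Seq (fft K [::] z)
       (\big[@Seq _/Skip]_(m <- iota 0 N.+1)
          scale (Val (o + m)) (chirp R nu m)^-1 (cell [::] m))))).

Lemma within_dct_block K (z : R[i]) (tau : nat -> R[i]) (o : nat) s :
  (forall k, (k < 2 ^ K)%N ->
     \sum_(a < 2 ^ K) z ^+ (k * a) * tau a = chirp R nu k) ->
  (forall k, K = k.+1 -> z ^+ (2 ^ k) = -1) ->
  (3 * N <= 2 ^ K)%N ->
  within (7 * (K.+1 * 2 ^ K)) (dct_block K z tau o) s (fun s' =>
    (forall m, (m < N.+1)%N -> s' (Val (o + m)) =
       \sum_(n < N.+1) (dct_coef R nu m n)%:C * s (Val (o + n))) /\
    (forall y, ~~ is_tmp y ->
       (forall m, (m < N.+1)%N -> y != Val (o + m)) -> s' y = s y)).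
Proof.
move=> Htau Hz NL; set L := (2 ^ K)%N in Htau NL *.
apply: (@within_weaken _
  (L * 1 + (2 * K * L + (L * 1 + (2 * K * L + N.+1 * 1))))%N
          _ _ _ _ _ _ _ (fun s' H => H)); last by nia.
have nb y : ~~ is_tmp y -> ~ below [::] y by move=> yt [x [q e]]; rewrite e in yt.
have cell_tmp y j : ~~ is_tmp y -> y != cell [::] j.
  by move=> yt; apply/eqP => e; rewrite e in yt.
have tmp_scr y : ~~ is_tmp y -> y != scratch.
  by move=> yt; apply/eqP => e; rewrite e in yt.
pose u j := if (j < 2 * N)%N
  then 2^-1 / chirp R nu j * s (Val (o + fold_index nu j)) else 0.
rewrite /dct_block -/L; apply: within_seq; rewrite -{1}(size_iota 0 L).
apply: (within_weaken (@within_assign _ _ (iota 0 L) _ 1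
  (cell [::]) (pred1 scratch) u s (iota_uniq _ _) _ _ _)) => //.
- by move=> i j _ _; apply: cell_inj.
- move=> j s1 _ agree; case: ifP => jN; rewrite /u jN.
    apply: (within_weaken (@within_scale _ _ _ _ _ _ _)) => //.
    by move=> s2 [-> H]; rewrite agree.
  apply: (@within_weaken _ 0 _ _ _ _ _ _ _ (fun s' H => H)) => //.
  apply: within_const; rewrite updateE eqxx; split=> // y _ yz.
  by rewrite updateE (negbTE yz).
move=> s1 [H1 F1].
apply: within_seq; apply: (within_weaken (@within_fft _ K [::] z s1 Hz)) => //.
move=> s2 [H2 F2].
apply: within_seq; rewrite -{1}(size_iota 0 L).
apply: (within_weaken (@within_assign _ _ (iota 0 L) _ 1
  (cell [::]) (pred1 scratch) (fun j => tau j * s2 (cell [::] j)) s2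
  (iota_uniq _ _) _ _ _)) => //.
- by move=> i j _ _; apply: cell_inj.
- move=> j s3 _ agree; apply: (within_weaken (@within_scale _ _ _ _ _ _ _)) => //.
  move=> s4 [-> H]; rewrite agree //.
  by move=> i _ ij; apply/eqP => /cell_inj e; rewrite e eqxx in ij.
move=> s3 [H3 F3].
apply: within_seq; apply: (within_weaken (@within_fft _ K [::] z s3 Hz)) => //.
move=> s4 [H4 F4].
rewrite -{1}(size_iota 0 N.+1).
apply: (within_weaken (@within_assign _ _ (iota 0 N.+1) _ 1
  (fun m => Val (o + m)) (pred1 scratch)
  (fun m => (chirp R nu m)^-1 * s4 (cell [::] m)) s4
  (iota_uniq _ _) _ _ _)) => //.
- by move=> i j _ _ [/addnI].
- move=> m s5 _ agree; apply: (within_weaken (@within_scale _ _ _ _ _ _ _)) => //.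
  by move=> s6 [-> H]; rewrite agree.
move=> s5 [H5 F5]; split=> [m mN|y yt Hy]; last first.
  rewrite F5 ?F4 ?F3 ?F2 ?F1 ?tmp_scr //; try exact: nb.
  - by move=> i _; apply: cell_tmp.
  - by move=> i _; apply: cell_tmp.
  - by move=> m; rewrite mem_iota; apply: Hy.
rewrite H5 ?mem_iota // H4; last by rewrite -/L; lia.
rewrite -(@bluestein R nu L z tau (fun n => s (Val (o + n))) m) //.
congr (_ * _); apply: eq_bigr => a _; congr (_ * _).
rewrite H3 ?mem_iota ?ltn_ord // H2 ?ltn_ord //; congr (_ * _).
by apply: eq_bigr => j _; rewrite H1 ?mem_iota ?ltn_ord.
Qed.

Definition dct_prog (M K : nat) (z : R[i]) (tau : nat -> R[i]) : prog :=
  \big[@Seq _/Skip]_(i <- iota 0 M) dct_block K z tau (i * N.+1).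

Lemma within_dct_prog M K (z : R[i]) (tau : nat -> R[i]) s :
  (forall k, (k < 2 ^ K)%N ->
     \sum_(a < 2 ^ K) z ^+ (k * a) * tau a = chirp R nu k) ->
  (forall k, K = k.+1 -> z ^+ (2 ^ k) = -1) ->
  (3 * N <= 2 ^ K)%N ->
  within (M * (7 * (K.+1 * 2 ^ K))) (dct_prog M K z tau) s (fun s' =>
    (forall i m, (i < M)%N -> (m < N.+1)%N -> s' (Val (i * N.+1 + m)) =
       \sum_(n < N.+1) (dct_coef R nu m n)%:C * s (Val (i * N.+1 + n))) /\
    (forall y, ~~ is_tmp y -> (forall k, y != Val k) -> s' y = s y)).
Proof.
move=> Htau Hz NL; rewrite -{1}(size_iota 0 M).
pose W (i : nat) (y : reg) := if y is Val k then (k %/ N.+1 == i)%N else false.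
pose v (i : nat) (y : reg) := if y is Val k then
  \sum_(n < N.+1) (dct_coef R nu (k %% N.+1) n)%:C * s (Val (i * N.+1 + n)) else 0.
have WE i m : (m < N.+1)%N -> W i (Val (i * N.+1 + m)).
  by move=> mN; rewrite /W divnMDl // divn_small // addn0.
apply: (within_weaken (@within_par _ _ (iota 0 M) _ _ W is_tmp v s
  (iota_uniq _ _) _ _)) => //.
- by move=> i j y _ _; case: y => //= k /eqP-> /eqP.
- move=> i s1 _ agree.
  apply: (within_weaken (@within_dct_block K z tau (i * N.+1) s1 Htau Hz NL)) => //.
  move=> s2 [H F] y yt; case: ifP => wy; last first.
    rewrite F // => m mN; apply/eqP => e; by rewrite e WE in wy.
  case: y yt wy => //= k _ /eqP ki.
  have -> : k = (i * N.+1 + k %% N.+1)%N by rewrite -ki -divn_eq.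
  rewrite H ?ltn_mod // modnMDl modn_mod; apply: eq_bigr => n _; congr (_ * _).
  apply: agree => // j _ ji; rewrite /W divnMDl // divn_small // addn0.
  by rewrite eq_sym.
move=> s' Hs; split=> [i m iM mN|y yt Hy].
  have [/(_ i) -> //] := Hs (Val (i * N.+1 + m)) isT; rewrite ?mem_iota ?WE //.
  by rewrite /v modnMDl modn_small.
have [_ -> //] := Hs y yt; move=> i _; case: y yt Hy => //= k _ /(_ k).
by rewrite eqxx.
Qed.

(** The smallest power of two that reaches 3 N is less than 6 N <= 12 nu. *)
Lemma exists_dct_prog M : (0 < nu)%N -> exists K (p : prog),
  [/\ (2 ^ K <= 12 * nu)%N &
   forall s, within (M * (7 * (K.+1 * 2 ^ K))) p s (fun s' =>
    (forall i m, (i < M)%N -> (m < N.+1)%N -> s' (Val (i * N.+1 + m)) =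
       \sum_(n < N.+1) (dct_coef R nu m n)%:C * s (Val (i * N.+1 + n))) /\
    (forall y, ~~ is_tmp y -> (forall k, y != Val k) -> s' y = s y))].
Proof.
move=> nu0; pose K := up_log 2 (3 * N).
have /andP[lo hi] := @up_log_bounds 2 (3 * N) isT ltac:(lia).
rewrite -/K in lo hi.
have [k Kk] : exists k, K = k.+1.
  by exists K.-1; rewrite prednK // up_log_gt0; lia.
have [z zk] := exists_pow2_root R k.
have pz := primitive_root_pow2 (_ : 1 + 1 != 0 :> R[i]) zk.
have {}pz : (2 ^ K).-primitive_root z.
  by rewrite Kk; apply: pz; rewrite -[1 + 1]/(2%:R) pnatr_eq0.
have [tau Htau] := fourier_interpolation (chirp R nu) pz.
exists K, (dct_prog M K z tau); split.
  move: lo; rewrite Kk /= expnS; lia.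
move=> s; apply: within_dct_prog => // k'; rewrite Kk => -[<-]; exact: zk.
Qed.

End DctProgram.

(** * The reduced system *)

Section Blocks.
Variables (F : fieldType) (M N : nat).

Lemma big_mxtens (f : 'I_(M * N) -> F) :
  \sum_k f k = \sum_i \sum_m f (mxtens_index (i, m)).
Proof.
rewrite pair_bigA /= (reindex (@mxtens_index M N)) /=; last first.
  by exists (@mxtens_unindex M N) => k _; rewrite (mxtens_indexK, mxtens_unindexK).
by apply: eq_bigr => -[i m] _.
Qed.

Lemma mul_blockwise (B : 'M[F]_N) q (A : 'M[F]_(M * N, q)) i m l :
  (blockwise M B *m A) (mxtens_index (i, m)) l =
  \sum_m' B m m' * A (mxtens_index (i, m')) l.
Proof.
rewrite mxE big_mxtens (bigD1 i) //= [X in _ + X]big1 ?addr0 => [|i' ii'].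
  by apply: eq_bigr => m' _; rewrite mxE !mxtens_indexK /= mxE eqxx mul1r.
apply: big1 => m' _; rewrite mxE !mxtens_indexK /= mxE eq_sym (negbTE ii').
by rewrite !mul0r.
Qed.

Lemma mul_mx_blockwise (B : 'M[F]_N) q (A : 'M[F]_(q, M * N)) l j n :
  (A *m blockwise M B) l (mxtens_index (j, n)) =
  \sum_n' A l (mxtens_index (j, n')) * B n' n.
Proof.
rewrite mxE big_mxtens (bigD1 j) //= [X in _ + X]big1 ?addr0 => [|i' ii'].
  by apply: eq_bigr => m' _; rewrite mxE !mxtens_indexK /= mxE eqxx mul1r.
apply: big1 => m' _; rewrite [X in _ * X]mxE !mxtens_indexK /= mxE (negbTE ii').
by rewrite mul0r mulr0.
Qed.

Lemma blockwise_inj (B : 'M[F]_N) q (v w : 'M[F]_(M * N, q)) :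
  (forall x y : 'M[F]_(N, q), B *m x = B *m y -> x = y) ->
  blockwise M B *m v = blockwise M B *m w -> v = w.
Proof.
move=> injB e; apply/matrixP => k l; case: (mxtens_indexP k) => i m.
pose x (v : 'M[F]_(M * N, q)) : 'M[F]_(N, q) :=
  \matrix_(m, l) v (mxtens_index (i, m)) l.
suff exy : B *m x v = B *m x w.
  by move/matrixP/(_ m l): (injB _ _ exy); rewrite !mxE.
apply/matrixP => m' l'.
have := congr1 (fun u : 'M[F]__ => u (mxtens_index (i, m')) l') e.
rewrite !mul_blockwise !mxE => e'.
under eq_bigr do rewrite mxE; under [RHS]eq_bigr do rewrite mxE.
exact: e'.
Qed.

Lemma swap_indexE (i : 'I_M) (m : 'I_N) :
  swap_index (mxtens_index (m, i)) = mxtens_index (i, m).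
Proof. by rewrite /swap_index mxtens_indexK. Qed.

Lemma swap_index_bij : bijective (@swap_index M N).
Proof.
by exists (@swap_index N M) => k; rewrite /swap_index mxtens_indexK mxtens_unindexK.
Qed.

Lemma reorder_mul (A : 'M[F]_(M * N)) (v : 'cV[F]_(M * N)) :
  reorder_mx A *m reorder_col v = reorder_col (A *m v).
Proof.
apply/matrixP => k l; rewrite !mxE.
rewrite [RHS](reindex (@swap_index M N)) /=; last exact/onW_bij/swap_index_bij.
by apply: eq_bigr => j _; rewrite !mxE.
Qed.

Lemma reorder_col_inj : injective (@reorder_col F M N).
Proof.
move=> v w /matrixP e; apply/matrixP => k l.
have [g gK Kg] := swap_index_bij.
by have := e (g k) l; rewrite !mxE Kg.
Qed.

End Blocks.

Section Projection.
Variables (F : fieldType) (M nu : nat).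

Lemma mul_proj q (A : 'M[F]_(M * nu.+2, q)) i m l :
  (proj_mx0 F M nu *m A) (mxtens_index (i, m)) l =
  (inner_index nu m)%:R * A (mxtens_index (i, m)) l.
Proof.
rewrite mul_blockwise (bigD1 m) //= big1 ?addr0 => [|m' mm'].
  by rewrite mxE eqxx.
by rewrite mxE eq_sym (negbTE mm') mul0r.
Qed.

Lemma mul_mx_proj q (A : 'M[F]_(q, M * nu.+2)) l j n :
  (A *m proj_mx0 F M nu) l (mxtens_index (j, n)) =
  A l (mxtens_index (j, n)) * (inner_index nu n)%:R.
Proof.
rewrite mul_mx_blockwise (bigD1 n) //= big1 ?addr0 => [|m' mm'].
  by rewrite mxE eqxx.
by rewrite mxE (negbTE mm') mulr0.
Qed.

Lemma proj_idem q (A : 'M[F]_(M * nu.+2, q)) :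
  proj_mx0 F M nu *m (proj_mx0 F M nu *m A) = proj_mx0 F M nu *m A.
Proof.
apply/matrixP => k l; case: (mxtens_indexP k) => i m.
by rewrite !mul_proj mulrA -natrM mulnb andbb.
Qed.

End Projection.

Section Reduced.
Variables (R : realType) (M nu : nat).
Local Notation N := nu.+1.
Local Notation C := R[i].

(** The polynomial whose values at the nodes form column n of a block of the
    collocation matrix. *)
Definition colloc_poly (diag : bool) (r g : {poly C}) (n : nat) : {poly C} :=
  (1 - 'X^2) * (r * (chebT C n)^`() *+ diag + g * chebT C n).

Lemma colloc_polyE diag r g n : colloc_poly diag r g n =
  (r * 'X *+ (diag * n) + g * (1 - 'X^2)) * chebT C n
  - (r *+ (diag * n)) * chebT C n.+1.
Proof.
rewrite /colloc_poly mulrDr mulrnAr mulrCA chebT_deriv.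
case: diag; rewrite ?mulr0n ?mulr1n ?mul1n ?mul0n ?mulr0n; ring.
Qed.

(** In [colloc_polyE], the factor of T_n has degree at most d + 3, while that of
    T_(n+1) has degree at most d. *)
Lemma colloc_poly_far d diag (r g : {poly C}) m n :
  (size r <= d.+1)%N -> (size g <= d.+2)%N -> (m <= N)%N -> (n <= nu)%N ->
  (d + 3 < `|m - n|)%N ->
  \sum_(k < N.+1) (dct_coef R nu m k)%:C *
     (colloc_poly diag r g n).[(cos (node R nu k))%:C] = 0.
Proof.
move=> sr sg mN nN far.
pose p1 := r * 'X *+ (diag * n) + g * (1 - 'X^2).
pose p2 := r *+ (diag * n).
have s2 : (size p2 <= d.+1)%N.
  by rewrite /p2 -mulr_natr -polyC_natr mulrC mul_polyC (leq_trans (size_scale_leq _ _)).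
have s1 : (size p1 <= d + 4)%N.
  rewrite /p1 (leq_trans (size_polyD _ _)) // geq_max; apply/andP; split.
    rewrite -mulr_natr -polyC_natr mulrC mul_polyC.
    rewrite (leq_trans (size_scale_leq _ _)) // (leq_trans (size_polyMleq _ _)) //.
    by rewrite size_polyX; lia.
  have sX : (size (1 - 'X^2 : {poly C})%R <= 3)%N.
    rewrite (leq_trans (size_polyD _ _)) // geq_max size_poly1 size_polyN.
    by rewrite size_polyXn.
  by rewrite (leq_trans (size_polyMleq _ _)) //; lia.
transitivity (
  \sum_(k < N.+1) (dct_coef R nu m k)%:C *
     (p1.[(cos (node R nu k))%:C] * (cos (n%:R * node R nu k))%:C) -
  \sum_(k < N.+1) (dct_coef R nu m k)%:C *
     (p2.[(cos (node R nu k))%:C] * (cos (n.+1%:R * node R nu k))%:C)).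
  rewrite -sumrB; apply: eq_bigr => k _.
  rewrite colloc_polyE -/p1 -/p2 hornerD hornerN !hornerM.
  by rewrite !chebT_cos mulrBr.
by rewrite !dct_poly_far ?subr0 //; lia.
Qed.

Section Entries.
Variables (G : R -> 'M[C]_M) (num den : 'M[{poly C}]_M) (r : {poly C}).
Hypothesis hG : lowest_terms G num den.
Hypothesis hr : is_lcm_entries den r.
Let rG := clear_denoms num den r.

Lemma clear_denoms_horner x i j : -1 <= x <= 1 ->
  (rG i j).[x%:C] = r.[x%:C] * G x i j.
Proof.
move=> hx; have [_ /(_ x hx) [d0 ->]] := hG i j.
have [/(_ i j)/divpK e _] := hr.
rewrite mxE hornerM -[in RHS]e hornerM; field.
exact: d0.
Qed.

Lemma colloc_mxE i j (m n : 'I_nu.+2) :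
  colloc_mx nu G r (mxtens_index (i, m)) (mxtens_index (j, n)) =
  (colloc_poly (i == j) r (rG j i) n).[(cos (node R nu m))%:C].
Proof.
rewrite mxE !mxtens_indexK mxE /colloc_poly !hornerM hornerD hornerN hornerXn.
rewrite hornerC !hornerD hornerMn !hornerM /= clear_denoms_horner; last first.
  by rewrite cos_geN1 cos_le1.
by rewrite mxE mulr_natl.
Qed.

Lemma reduced_mxE (m n : 'I_nu.+2) (i j : 'I_M) :
  reduced_mx nu G r (mxtens_index (m, i)) (mxtens_index (n, j)) =
  (\sum_(k < N.+1) (dct_coef R nu m k)%:C * ((inner_index nu k)%:R *
     (colloc_poly (i == j) r (rG j i) n).[(cos (node R nu k))%:C]))
  * (inner_index nu n)%:R.
Proof.
rewrite mxE !swap_indexE mul_blockwise mulr_suml; apply: eq_bigr => k _.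
by rewrite dct1E mul_mx_proj mul_proj colloc_mxE mulrA.
Qed.

(** The factor 1 - x^2 vanishes at both end points, so that the projection on
    the left does not alter the matrix. *)
Lemma inner_colloc diag g n k : (k <= N)%N ->
  (inner_index nu k)%:R * (colloc_poly diag r g n).[(cos (node R nu k))%:C] =
  (colloc_poly diag r g n).[(cos (node R nu k))%:C].
Proof.
move=> kN; have [|] := boolP (inner_index nu k); first by rewrite mul1r.
rewrite /inner_index => k0; rewrite mul0r hornerM hornerD hornerN hornerXn hornerC.
have -> : (cos (node R nu k))%:C ^+ 2 = 1 :> C; last by rewrite subrr mul0r.
have [->|->] : k = 0%N \/ k = N by lia.
  by rewrite /node !mul0r cos0 expr1n.
rewrite /node mulrAC divff ?pnatr_eq0 // mul1r cospi rmorphN1 sqrrN expr1n //.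
Qed.

(** Interleaving puts the entry (m, n) of the block (i, j) at distance
    |M (m - n) + i - j| <= M |m - n| + M - 1 from the diagonal. *)
Lemma reduced_band d b : (0 < M)%N ->
  (size r <= d.+1)%N -> (forall i j, (size (rG i j) <= d.+2)%N) ->
  b = (M * (d + 4) - 1)%N ->
  forall k l : 'I_(nu.+2 * M), (b < `|k - l|)%N -> reduced_mx nu G r k l = 0.
Proof.
move=> M0 sr sG bE k l; case: (mxtens_indexP k) => m i; case: (mxtens_indexP l) => n j.
move=> /= far; rewrite reduced_mxE.
have [nin|] := boolP (inner_index nu n); last by rewrite mulr0.
rewrite (eq_bigr _ (fun k _ => congr1 (fun u => _ * u)
  (inner_colloc _ _ _ (leq_ord k)))).
rewrite (@colloc_poly_far d) ?mul0r ?leq_ord //.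
  by move: nin; rewrite /inner_index; lia.
rewrite ltnNge; apply: contraL far => near; rewrite -leqNgt bE.
have := ltn_ord i; have := ltn_ord j.
have : (m <= n + (d + 3))%N by lia. have : (n <= m + (d + 3))%N by lia.
nia.
Qed.

End Entries.
End Reduced.

(** * Assembling the reduced system *)

Section Assembly.
Variables (R : realType) (M nu d : nat).
Local Notation N := nu.+1.
Local Notation C := R[i].
Local Notation prog := (prog C).
Implicit Types (s : store C).
Local Notation c k := ((cos (node R nu k))%:C : C).

(** The entries of the reduced matrix depend linearly on the coefficients of r
    and of rG.  The factors of the coefficients number t are the DCT-I of the
    nodal values obtained from x^t, and depend on the indices only. *)
Definition weight_r (diag : bool) (m n t : nat) : C :=
  (\sum_(k < N.+1) (dct_coef R nu m k)%:C * ((inner_index nu k)%:R *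
     ((1 - c k ^+ 2) * (c k ^+ t * (chebT C n)^`().[c k] *+ diag))))
  * (inner_index nu n)%:R.

Definition weight_g (m n t : nat) : C :=
  (\sum_(k < N.+1) (dct_coef R nu m k)%:C * ((inner_index nu k)%:R *
     ((1 - c k ^+ 2) * (c k ^+ t * (chebT C n).[c k]))))
  * (inner_index nu n)%:R.

Lemma entry_weights diag (r g : {poly C}) (m n : nat) :
  (size r <= d.+1)%N -> (size g <= d.+2)%N ->
  (\sum_(k < N.+1) (dct_coef R nu m k)%:C * ((inner_index nu k)%:R *
     (colloc_poly diag r g n).[c k])) * (inner_index nu n)%:R =
  \sum_(t < d.+1) weight_r diag m n t * r`_t
  + \sum_(t < d.+2) weight_g m n t * g`_t.
Proof.
move=> sr sg; rewrite /weight_r /weight_g.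
under [X in _ = X + _]eq_bigr do rewrite mulrAC mulr_suml.
under [X in _ = _ + X]eq_bigr do rewrite mulrAC mulr_suml.
rewrite -!mulr_suml -mulrDl; congr (_ * _).
rewrite exchange_big [X in _ = _ + X]exchange_big -big_split /=.
apply: eq_bigr => k _.
rewrite /colloc_poly hornerM hornerD hornerN hornerXn hornerC.
rewrite hornerD hornerMn !hornerM (horner_coef_wide _ sr) (horner_coef_wide _ sg).
rewrite -mulrnAr !mulr_suml mulrDr !mulrDr !mulr_sumr.
congr (_ + _); apply: eq_bigr => t _; case: diag; rewrite ?mulr1n ?mulr0n; ring.
Qed.

Definition entry_prog (kl : nat * nat) : prog :=
  let: (k, l) := kl in
  lincomb (Mat k l)
    ([seq (weight_r (k %% M == l %% M)%N (k %/ M) (l %/ M) t, InR t)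
        | t <- iota 0 d.+1]
     ++ [seq (weight_g (k %/ M) (l %/ M) t, InG (l %% M) (k %% M) t)
        | t <- iota 0 d.+2]).

(** Every row gets exactly 2 b + 1 columns starting at k - b.  Because of the
    truncated subtraction and of the right border, some of them fall outside the
    band or the matrix, where the contents of the registers do not matter. *)
Definition band_indices (b n : nat) : seq (nat * nat) :=
  [seq (k, l) | k <- iota 0 n, l <- iota (k - b) (2 * b + 1)].

Lemma band_indices_uniq b n : uniq (band_indices b n).
Proof.
apply: allpairs_uniq_dep => [|k _|[k l] [k' l'] _ _ /= [-> ->]];
  rewrite ?iota_uniq //.
Qed.

Lemma size_band_indices b n : size (band_indices b n) = (n * (2 * b + 1))%N.
Proof.
rewrite size_allpairs_dep (eq_map (_ : _ =1 fun=> (2 * b + 1)%N)); last first.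
  by move=> k; rewrite size_iota.
by rewrite sumnE big_map big_const_seq count_predT size_iota iter_addn_0 mulnC.
Qed.

Lemma mem_band_indices b n (k l : nat) : (k < n)%N -> (`|k - l| <= b)%N ->
  (k, l) \in band_indices b n.
Proof.
move=> kn kl; apply/allpairsPdep; exists k, l; split=> //.
  by rewrite mem_iota.
by rewrite mem_iota; lia.
Qed.

Lemma sum_iota (f : nat -> C) n : \sum_(t <- iota 0 n) f t = \sum_(t < n) f t.
Proof. by rewrite -(big_mkord xpredT) /index_iota subn0. Qed.

Definition rhs_prog (k : nat) : prog :=
  let m := (k %% nu.+2)%N in
  Seq (lincomb (Val k)
         [seq ((inner_index nu m)%:R * (1 - c m ^+ 2) * c m ^+ t, InR t)
            | t <- iota 0 d.+1])
      (Arith OpMul (Val k) (Val k) (InF (k %/ nu.+2) m)).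

Definition assemble_prog (b : nat) : prog :=
  Seq (\big[@Seq C/Skip]_(kl <- band_indices b (nu.+2 * M)) entry_prog kl)
      (\big[@Seq C/Skip]_(k <- iota 0 (M * nu.+2)) rhs_prog k).

Lemma within_assemble b s :
  within (nu.+2 * M * (2 * b + 1) * (4 * d + 6) + M * nu.+2 * (2 * d + 3))
    (assemble_prog b) s (fun s' =>
    (forall k l : nat, (k < nu.+2 * M)%N -> (`|k - l| <= b)%N -> s' (Mat k l) =
       \sum_(t < d.+1) weight_r (k %% M == l %% M)%N (k %/ M) (l %/ M) t
                         * s (InR t)
       + \sum_(t < d.+2) weight_g (k %/ M) (l %/ M) t
                           * s (InG (l %% M) (k %% M) t)) /\
    (forall k, (k < M * nu.+2)%N -> s' (Val k) =
       (\sum_(t < d.+1) (inner_index nu (k %% nu.+2))%:R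
            * (1 - c (k %% nu.+2)%N ^+ 2) * c (k %% nu.+2)%N ^+ t * s (InR t))
       * s (InF (k %/ nu.+2) (k %% nu.+2)))).
Proof.
apply: within_seq; rewrite -size_band_indices.
pose v (kl : nat * nat) : C := let: (k, l) := kl in
  \sum_(t < d.+1) weight_r (k %% M == l %% M)%N (k %/ M) (l %/ M) t * s (InR t)
  + \sum_(t < d.+2) weight_g (k %/ M) (l %/ M) t * s (InG (l %% M) (k %% M) t).
apply: (within_weaken (@within_assign _ _ (band_indices b (nu.+2 * M)) _
  (4 * d + 6) (fun kl => Mat kl.1 kl.2) (pred1 scratch) v s
  (band_indices_uniq _ _) _ _ _)) => //.
- by move=> [k l] [k' l'] _ _ /= [-> ->].
- move=> [k l] s1 _ agree.
  have E1 t : s1 (InR t) = s (InR t) by apply: agree.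
  have E2 i j t : s1 (InG i j t) = s (InG i j t) by apply: agree.
  apply: (within_weaken (@within_lincomb _ _ _ _ _ _)) => //.
  + by move=> ax; rewrite mem_cat => /orP[]/mapP[t _ ->] /=; apply/andP; split.
  + by rewrite size_cat !size_map !size_iota; lia.
  move=> s2 [-> H]; split=> //; rewrite big_cat !big_map !sum_iota /v /=.
  by congr (_ + _); apply: eq_bigr => t _; rewrite ?E1 ?E2.
move=> s1 [H1 F1].
have E1 t : s1 (InR t) = s (InR t) by apply: F1.
have E2 i m : s1 (InF i m) = s (InF i m) by apply: F1.
rewrite -{1}(size_iota 0 (M * nu.+2)).
apply: (within_weaken (@within_assign _ _ (iota 0 (M * nu.+2)) _
  (2 * d + 3) Val (pred1 scratch) (fun k => (\sum_(t < d.+1)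
     (inner_index nu (k %% nu.+2))%:R * (1 - c (k %% nu.+2)%N ^+ 2)
      * c (k %% nu.+2)%N ^+ t * s (InR t)) * s (InF (k %/ nu.+2) (k %% nu.+2)))
  s1 (iota_uniq _ _) _ _ _)) => //.
- by move=> i j _ _ [].
- move=> k s2 _ agree.
  have G1 t : s2 (InR t) = s (InR t) by rewrite agree.
  have G2 i m : s2 (InF i m) = s (InF i m) by rewrite agree.
  have -> : (2 * d + 3 = 2 * d.+1 + 1)%N by lia.
  apply: within_seq.
  apply: (within_weaken (@within_lincomb _ _ _ _ _ _)) => //.
  + by move=> ax /mapP[t _ ->] /=; apply/andP; split.
  + by rewrite size_map size_iota.
  move=> s3 [H3 F3]; apply: within_arith; first by [].
  rewrite updateE eqxx H3 F3 // G2 big_map; split.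
    rewrite sum_iota.
    by congr (_ * _); apply: eq_bigr => t _; rewrite G1.
  by move=> y yt yv; rewrite updateE (negbTE yv) F3.
move=> s2 [H2 F2]; split=> [k l kn kl|k kn]; last by rewrite H2 ?mem_iota.
rewrite F2 //; exact: (H1 (k, l) (mem_band_indices kn kl)).
Qed.

End Assembly.

(** * Correctness and cost of the whole program *)

Lemma within_seq3 (F : fieldType) c c' (p1 p2 p3 q : prog F) s Q :
  within c (Seq p1 (Seq p2 p3)) s (fun s' => within c' q s' Q) ->
  within (c + c') (Seq p1 (Seq p2 (Seq p3 q))) s Q.
Proof.
move=> [n [s' [/=]]].
case e1: (run p1 s) => [[n1 s1]|//]; case e2: (run p2 s1) => [[n2 s2]|//].
case e3: (run p3 s2) => [[n3 s3]|//] [<- <-] nc [m [s'' [e mc Qs]]].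
exists (n1 + (n2 + (n3 + m)))%N, s''; rewrite /= e1 e2 e3 e; split=> //.
by rewrite addnA addnA leq_add // -addnA.
Qed.

Lemma within_runs_within (R : realType) (F : fieldType) (p : prog F) s c (x : R) Q :
  within c p s Q -> c%:R <= x -> runs_within p s x Q.
Proof.
move=> [n [s' [r nc Qs]]] cx; exists n, s'; split=> //.
by apply: le_trans cx; rewrite ler_nat.
Qed.

Section Copies.
Variable F : fieldType.

Lemma within_gather M N (s : store F) :
  within 0 (gather_prog F M N) s (fun s' =>
    (forall k : 'I_(N * M), s' (Rhs k) = s (Val (@swap_index M N k))) /\
    (forall y, (forall k : 'I_(N * M), y != Rhs k) -> s' y = s y)).
Proof.
rewrite -(muln0 (size (index_enum 'I_(N * M)))).
apply: (within_weaken (@within_assign _ _ (index_enum 'I_(N * M))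
  (fun k => Move (Rhs k) (Val (@swap_index M N k))) 0 (fun k => Rhs k) pred0
  (fun k => s (Val (@swap_index M N k))) s (index_enum_uniq _) _ _ _)) => //.
- by move=> k l _ _ [] /val_inj.
- move=> k s1 _ agree; apply: within_move; rewrite updateE eqxx agree //.
  by split=> // y _ yz; rewrite updateE (negbTE yz).
- by move=> s' [H1 H2]; split=> [k|y Hy]; [rewrite H1 ?mem_index_enum|rewrite H2].
Qed.

Lemma within_scatter M nu (s : store F) :
  within 0 (scatter_prog F M nu) s (fun s' => forall k : 'I_(M * nu.+2),
    s' (Out k) = if inner_index nu (mxtens_unindex k).2
                 then s (Sol (@swap_index nu.+2 M k)) else 0).
Proof.
rewrite -(muln0 (size (index_enum 'I_(M * nu.+2)))).
apply: (within_weaken (@within_assign _ _ (index_enum 'I_(M * nu.+2))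
  (fun k => if inner_index nu (mxtens_unindex k).2
    then Move (Out k) (Sol (@swap_index nu.+2 M k)) else Const (Out k) 0)
  0 (fun k => Out k) pred0
  (fun k => if inner_index nu (mxtens_unindex k).2
    then s (Sol (@swap_index nu.+2 M k)) else 0) s (index_enum_uniq _) _ _ _)) => //.
- by move=> k l _ _ [] /val_inj.
- move=> k s1 _ agree; case: ifP => _; [apply: within_move|apply: within_const];
    rewrite updateE eqxx ?agree //;
    by split=> // y _ yz; rewrite updateE (negbTE yz).
- by move=> s' [H1 H2] k; rewrite H1 ?mem_index_enum.
Qed.

Lemma within_solver n b (s : store F) (B : 'M[F]_n) (g : 'cV[F]_n) :
  bandwidth_at_most (2 * b + 1) B -> holds_band (2 * b + 1) s B ->
  holds_vec Rhs s g -> (exists y, B *m y = g) ->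
  within (n * column_cost b) (band_solve F n b n (iota 0 n)) s
    (fun s' => exists2 y : 'cV[F]_n, holds_vec Sol s' y & B *m y = g).
Proof.
move=> [b' hb HB] hB hg [x Hx].
have bandE (i l : 'I_n) : band b s i l = B i l.
  rewrite /band; case: ifP => il; first by rewrite hB //; lia.
  by rewrite HB //; lia.
apply: (within_weaken (@within_band_solve F n b n (iota 0 n) s _ _ _)) => //.
- exact: iota_ltn_sorted.
- exists (fun l => oapp (fun i => x i 0) 0 (insub l)) => i.
  rewrite mem_iota => /= iN; rewrite subnn big_mkord.
  have -> : s (Rhs i) = g (Ordinal iN) 0 by rewrite -(hg (Ordinal iN)).
  rewrite -Hx mxE; apply: eq_bigr => l _.
  by rewrite (bandE (Ordinal iN)) valK.
move=> s' [H _]; exists (\col_l s' (Sol l)) => [l|]; first by rewrite mxE.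
apply/matrixP => i j; rewrite ord1 -hg -H; last first.
  by rewrite mem_iota ltn_ord.
rewrite subnn big_mkord mxE; apply: eq_bigr => l _.
by rewrite bandE mxE.
Qed.

End Copies.

Section Correctness.
Variables (R : realType) (M nu d : nat).
Local Notation C := R[i].
Implicit Types (s : store C).

Lemma dct_prog_holds c (p : prog C) :
  (forall s, within c p s (fun s' =>
    (forall i m, (i < M)%N -> (m < nu.+2)%N -> s' (Val (i * nu.+2 + m)) =
       \sum_(n < nu.+2) (dct_coef R nu m n)%:C * s (Val (i * nu.+2 + n))) /\
    (forall y, ~~ is_tmp y -> (forall k, y != Val k) -> s' y = s y))) ->
  forall s (v : 'cV[C]_(M * nu.+2)), holds_vec Val s v ->
    within c p s (fun s' => holds_vec Val s' (blockwise M (dct1 R nu) *m v) /\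
      (forall y, ~~ is_tmp y -> (forall k, y != Val k) -> s' y = s y)).
Proof.
move=> Hp s v sv; apply: (within_weaken (Hp s)) => // s' [H F]; split=> // k.
case: (mxtens_indexP k) => i m; rewrite mul_blockwise /= H //.
by apply: eq_bigr => n _; rewrite dct1E -sv.
Qed.

Variables (G : R -> 'M[C]_M) (num den : 'M[{poly C}]_M) (r : {poly C}).
Variables (f : R -> 'cV[C]_M).
Hypothesis hG : lowest_terms G num den.
Hypothesis hr : is_lcm_entries den r.
Let rG := clear_denoms num den r.
Hypothesis hd : total_degree r rG = d.

Lemma size_lcm_le : (size r <= d.+1)%N.
Proof. by apply: leq_trans (leqSpred _) _; rewrite ltnS -hd leq_maxl. Qed.

Lemma size_clear_denoms_le i j : (size (rG i j) <= d.+2)%N.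
Proof.
have h1 := leq_bigmax (F := fun i => \max_(j < M) (size (rG i j)).-1) i.
have h2 := leq_bigmax (F := fun j => (size (rG i j)).-1) j.
apply: leq_trans (leqSpred _) _; rewrite ltnS.
apply: leq_trans (leq_trans h2 h1) _; apply: leq_trans (leqSpred _) _.
by rewrite ltnS -hd leq_maxr.
Qed.

Lemma assemble_holds b s : holds_input nu d r rG f s ->
  within (nu.+2 * M * (2 * b + 1) * (4 * d + 6) + M * nu.+2 * (2 * d + 3))
    (assemble_prog R M nu d b) s (fun s' =>
      holds_band (2 * b + 1) s' (reduced_mx nu G r) /\
      holds_vec Val s' (proj_mx0 C M nu *m colloc_rhs nu f r)).
Proof.
move=> [hR hGr hF]; apply: (within_weaken (@within_assemble R M nu d b s)) => //.
move=> s' [H1 H2]; split=> [k l kl|k].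
  rewrite H1 ?ltn_ord //; last lia.
  case: (mxtens_indexP k) => m i; case: (mxtens_indexP l) => n j.
  rewrite (reduced_mxE hG hr) (@entry_weights _ _ d) ?size_lcm_le //=; last first.
    exact: size_clear_denoms_le.
  have M0 : (0 < M)%N by apply: leq_ltn_trans (ltn_ord i).
  rewrite !modnMDl !modn_small // !divnMDl // !divn_small // !addn0.
  by congr (_ + _); apply: eq_bigr => t _; rewrite ?hR ?hGr ?leq_ord.
rewrite H2 ?ltn_ord //; case: (mxtens_indexP k) => i m.
rewrite mul_proj mxE mxtens_indexK /=.
rewrite !modnMDl !modn_small // !divnMDl // !divn_small // !addn0.
rewrite hF (horner_coef_wide _ size_lcm_le) mulrA mulr_sumr mulr_sumr.
rewrite -[cc_point R nu m]/(cos (node R nu m)); congr (_ * _).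
by apply: eq_bigr => t _; rewrite hR ?leq_ord //; ring.
Qed.

(** Reordering is a bijection and the blockwise DCT-I is injective, so both can be
    cancelled. *)
Lemma solution_of_reduced y :
  reduced_mx nu G r *m reorder_col y = reduced_rhs nu f r ->
  is_solution G f r (proj_mx0 C M nu *m y).
Proof.
rewrite /reduced_mx /reduced_rhs reorder_mul => /reorder_col_inj.
rewrite -[LHS]mulmxA => /(blockwise_inj (@dct1_inj R nu 1)) e.
by split; rewrite ?proj_idem // -!mulmxA proj_idem !mulmxA.
Qed.

Lemma reduced_of_solution a : is_solution G f r a ->
  reduced_mx nu G r *m reorder_col a = reduced_rhs nu f r.
Proof.
by move=> [e _]; rewrite /reduced_mx reorder_mul -[X in reorder_col X]mulmxA e.
Qed.

(** A solution of the reduced system is arbitrary in the components that the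
    projection kills; resetting them to 0 gives a solution of the collocation
    system. *)
Lemma scatter_solution s (y : 'cV[C]_(nu.+2 * M)) :
  holds_vec Sol s y -> reduced_mx nu G r *m y = reduced_rhs nu f r ->
  within 0 (scatter_prog C M nu) s (fun s' =>
    exists2 a : 'cV[C]_(M * nu.+2), holds_vec Out s' a & is_solution G f r a).
Proof.
move=> sy e; apply: (within_weaken (@within_scatter C M nu s)) => // s' H.
pose x : 'cV[C]_(M * nu.+2) := \col_k y (@swap_index nu.+2 M k) 0.
exists (proj_mx0 C M nu *m x) => [k|].
  rewrite H; case: (mxtens_indexP k) => i m; rewrite mxtens_indexK mul_proj mxE sy.
  by case: ifP => _; rewrite ?mul1r ?mul0r.
apply: solution_of_reduced; rewrite -e; congr (_ *m _).
apply/matrixP => k j; rewrite !mxE ord1; congr (y _ 0).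
by rewrite /swap_index mxtens_indexK mxtens_unindexK.
Qed.

End Correctness.

Section Costs.
Variable R : realType.

Lemma ln2_gt0 : 0 < ln 2 :> R.
Proof. by rewrite ln_gt0 // ltr1n. Qed.

(** From 2^(K + 1) <= 24 nu <= nu^6, the number K + 1 of levels is at most
    6 ln nu / ln 2. *)
Lemma dct_cost_le M nu K : (2 <= nu)%N -> (2 ^ K <= 12 * nu)%N ->
  (M * (7 * (K.+1 * 2 ^ K)))%:R <=
    504 / ln 2 * (M%:R * nu%:R * ln nu%:R) :> R.
Proof.
move=> nu2 hK; have l2 := ln2_gt0.
have hln : K.+1%:R * ln 2 <= 6 * ln nu%:R :> R.
  have -> : K.+1%:R * ln 2 = ln (2 ^+ K.+1) :> R by rewrite lnXn // mulr_natl.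
  have -> : 6 * ln nu%:R = ln (nu%:R ^+ 6) :> R.
    by rewrite lnXn ?ltr0n ?mulr_natl //; lia.
  rewrite ler_ln ?posrE ?exprn_gt0 ?ltr0n //; last by lia.
  rewrite -!natrX ler_nat expnS.
  have h : (2 ^ 5 <= nu ^ 5)%N by rewrite leq_exp2r.
  have -> : (nu ^ 6 = nu * nu ^ 5)%N by rewrite expnS.
  by move: h hK; rewrite (_ : (2 ^ 5 = 32)%N) //; nia.
apply: (@le_trans _ _ (M%:R * (84 * nu%:R) * K.+1%:R)).
  rewrite -!natrM ler_nat; nia.
rewrite -(ler_pM2r l2).
have -> : 504 / ln 2 * (M%:R * nu%:R * ln nu%:R) * ln 2 =
  M%:R * (84 * nu%:R) * (6 * ln nu%:R) :> R.
  by field; rewrite gt_eqF.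
by rewrite -[X in X <= _]mulrA ler_wpM2l ?mulr_ge0.
Qed.

(** With D = max (1, d), the dimension is at most 2 nu M, the width 2 b + 1 at
    most 10 M D, and 4 d + 6 at most 10 D. *)
Lemma band_cost_le M nu d b : (2 <= M)%N -> (2 <= nu)%N ->
  b = (M * (d + 4) - 1)%N ->
  (nu.+2 * M * (2 * b + 1) * (4 * d + 6) + M * nu.+2 * (2 * d + 3)
   <= 210 * (M ^ 3 * maxn 1 d ^ 2 * nu))%N /\
  (nu.+2 * M * column_cost b <= 440 * (M ^ 3 * maxn 1 d ^ 2 * nu))%N.
Proof.
move=> M2 nu2 bE; set D := maxn 1 d.
have D1 : (1 <= D)%N by rewrite /D; lia.
have dD : (d <= D)%N by rewrite /D; lia.
have hb1 : (2 * b + 1 <= 10 * (M * D))%N by rewrite bE; nia.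
have hb2 : (4 * b + 4 <= 20 * (M * D))%N by rewrite bE; nia.
have hn : (nu.+2 * M <= 2 * (nu * M))%N by nia.
have h6 : (4 * d + 6 <= 10 * D)%N by lia.
have h3 : (2 * d + 3 <= 5 * D)%N by lia.
split.
  apply: (@leq_trans (2 * (nu * M) * (10 * (M * D)) * (10 * D)
                      + 2 * (nu * M) * (5 * D))).
    rewrite (mulnC M); apply: leq_add; last exact: leq_mul.
    by apply: leq_mul => //; apply: leq_mul.
  have -> : (2 * (nu * M) * (10 * (M * D)) * (10 * D) =
    200 * (nu * M ^ 2 * D ^ 2))%N by ring.
  have -> : (210 * (M ^ 3 * D ^ 2 * nu) =
    200 * (nu * M ^ 2 * D ^ 2) * M + 10 * (nu * M * D) * (M ^ 2 * D))%N by ring.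
  have -> : (2 * (nu * M) * (5 * D) = 10 * (nu * M * D))%N by ring.
  by apply: leq_add; rewrite leq_pmulr // ?muln_gt0 ?expn_gt0; lia.
have hc : (column_cost b <= 220 * (M * D) ^ 2)%N.
  have p := leq_mul hb1 hb2.
  have q : (1 <= M * D)%N by rewrite muln_gt0; lia.
  rewrite /column_cost.
  have h4 : (20 * (M * D) <= 20 * (M * D) ^ 2)%N by rewrite leq_mul2l leq_pmulr.
  have -> : (220 * (M * D) ^ 2 =
    10 * (M * D) * (20 * (M * D)) + 20 * (M * D) ^ 2)%N by ring.
  by apply: leq_add => //; lia.
apply: leq_trans (leq_mul hn hc) _.
by apply: eq_leq; ring.
Qed.

End Costs.

Theorem proposition3 (R : realType) :
  exists K : R, forall M nu d : nat,
    (2 <= M)%N -> (0 < nu)%N -> ~~ odd nu -> (d + 1 <= nu)%N ->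
    let w := (2 * M * (d + 4) - 1)%N in
    let cost_dct := K * (M%:R * nu%:R * ln nu%:R) in
    let cost_band := K * (M%:R ^+ 3 * (maxn 1 d)%:R ^+ 2 * nu%:R) in
    exists assemble dct solve : prog R[i],
      [/\ is_dct_prog M nu dct cost_dct,
          is_band_solver (nu.+2 * M) w solve cost_band
        & forall (G : R -> 'M[R[i]]_M) (num den : 'M[{poly R[i]}]_M)
            (r : {poly R[i]}) (f : R -> 'cV[R[i]]_M) (s : store R[i]),
          lowest_terms G num den ->
          is_lcm_entries den r ->
          let rG := clear_denoms num den r in
          total_degree r rG = d ->
          holds_input nu d r rG f s ->
          [/\ bandwidth_at_most w (reduced_mx nu G r),
              runs_within (Seq assemble (Seq dct (gather_prog R[i] M nu.+2))) s
                (cost_dct + cost_band)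
                (fun s' => holds_band w s' (reduced_mx nu G r) /\
                           holds_vec Rhs s' (reduced_rhs nu f r))
            & (exists a : 'cV[R[i]]_(M * nu.+2), is_solution G f r a) ->
              runs_within
                (Seq assemble (Seq dct (Seq (gather_prog R[i] M nu.+2)
                   (Seq solve (scatter_prog R[i] M nu))))) s
                (cost_dct + cost_band)
                (fun s' => exists2 a : 'cV[R[i]]_(M * nu.+2),
                   holds_vec Out s' a & is_solution G f r a)]].
Proof.
(* 504 / ln 2 pays for the transforms, 210 for the assembly and 440 for the
   banded solver. *)
exists (504 / ln 2 + 650) => M nu d M2 nu0 nuE dnu w cost_dct cost_band.
have nu2 : (2 <= nu)%N by case: nu nu0 nuE {dnu cost_dct cost_band} => [|[]].
pose b := (M * (d + 4) - 1)%N.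
have wE : w = (2 * b + 1)%N by rewrite /w /b; nia.
have [hasm hsolve] := @band_cost_le M nu d b M2 nu2 erefl.
have [k [p [hk Hp]]] := exists_dct_prog R M nu0.
have {Hp} Hp := dct_prog_holds Hp.
set ca := (nu.+2 * M * (2 * b + 1) * (4 * d + 6) + M * nu.+2 * (2 * d + 3))%N
  in hasm.
set cd := (M * (7 * (k.+1 * 2 ^ k)))%N in Hp.
set cs := (nu.+2 * M * column_cost b)%N in hsolve.
set U := (M ^ 3 * maxn 1 d ^ 2 * nu)%N in hasm hsolve.
have l2 : 0 < 504 / ln 2 :> R by rewrite divr_gt0 ?ln2_gt0.
have V0 : 0 <= M%:R * nu%:R * ln nu%:R :> R.
  by rewrite !mulr_ge0 // ln_ge0 // ler1n.
have UE : M%:R ^+ 3 * (maxn 1 d)%:R ^+ 2 * nu%:R = U%:R :> R.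
  by rewrite -!natrX -!natrM.
have hcd : cd%:R <= cost_dct.
  apply: le_trans (dct_cost_le R M nu2 hk) _.
  by rewrite /cost_dct [leRHS]mulrDl lerDl mulr_ge0.
have hband (c e : nat) : (c <= e * U)%N -> (e <= 650)%N -> c%:R <= cost_band.
  move=> ce e650; rewrite /cost_band UE.
  have h : c%:R <= 650%:R * U%:R :> R.
    by rewrite -natrM ler_nat (leq_trans ce) // leq_mul2r e650 orbT.
  by apply: le_trans h _; rewrite [leRHS]mulrDl lerDr mulr_ge0 // ltW.
exists (assemble_prog R M nu d b), p,
  (band_solve R[i] (nu.+2 * M) b (nu.+2 * M) (iota 0 (nu.+2 * M))).
split.
- move=> s v sv; apply: within_runs_within hcd.
  by apply: (within_weaken (Hp s v sv)) => // s' [].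
- move=> s B g hB sB sg hy; rewrite wE in hB sB.
  by apply: within_runs_within (hband _ _ hsolve _) => //; apply: within_solver.
move=> G num den r f s hG hr rG hd hin.
have hB : bandwidth_at_most w (reduced_mx nu G r).
  exists b; first by rewrite wE.
  apply: (reduced_band hG hr (d := d)) => //; first by lia.
    exact: size_lcm_le hd.
  by move=> i j; exact: (size_clear_denoms_le hd).
have reduce : within (ca + cd)
    (Seq (assemble_prog R M nu d b) (Seq p (gather_prog R[i] M nu.+2))) s
    (fun s' => holds_band w s' (reduced_mx nu G r) /\
               holds_vec Rhs s' (reduced_rhs nu f r)).
  rewrite -[cd]addn0; apply: within_seq.
  apply: (within_weaken (assemble_holds hG hr hd b hin)) => // s1 [hB1 hV1].
  apply: within_seq; apply: (within_weaken (Hp _ _ hV1)) => // s2 [hV2 F2].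
  apply: (within_weaken (@within_gather _ M nu.+2 s2)) => // s3 [H3 F3].
  rewrite wE; split=> [i j ij|i]; last by rewrite H3 hV2 /reduced_rhs [RHS]mxE.
  by rewrite F3 // F2 // hB1.
split=> //.
  apply: within_runs_within reduce _; rewrite natrD addrC lerD //.
  exact: (hband _ _ hasm).
move=> [a Ha]; apply: (@within_runs_within _ _ _ _ ((ca + cd) + (cs + 0))%N).
  apply: within_seq3; apply: (within_weaken reduce) => // s1 [hB1 hR1].
  rewrite wE in hB hB1; apply: within_seq.
  apply: (within_weaken (within_solver hB hB1 hR1 _)) => //.
    by exists (reorder_col a); exact: reduced_of_solution.
  by move=> s2 [y hy ey]; exact: scatter_solution hy ey.
rewrite addn0 addnAC natrD addrC lerD //; apply: (hband _ 650%N) => //.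
by apply: leq_trans (leq_add hasm hsolve) _; rewrite -mulnDl.
Qed.
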